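(* Let $n \geq 3$ be an integer and let $N \geq n^{4n}$ be a positive integer. Let $x_1, x_2, \ldots, x_N \in \mathbb{S}_n$ be random points and let $X = (\mathbb{R}^n, \|\cdot\|_X)$ be the $n$-dimensional normed space with the unit ball $B_X = \operatorname{conv}\{\pm x_1, \pm x_2, \ldots, \pm x_N\}$. Then the probability that every hyperplane projection $P: X \to X$ satisfies $$\|P\|_X \geq 1 + c_n N^{-(2n^2+4n+6)},$$ where $$c_n = \frac{n^{2n^2+7n-11}}{e^{2n^2+7n+3}},$$ is at least $1 - \frac{3}{N}$.
   Context: $\mathbb{S}_n = \{x \in \mathbb{R}^n : \|x\| = 1\}$ is the Euclidean unit sphere in $\mathbb{R}^n$ (not in $\mathbb{R}^{n+1}$), where $\|\cdot\|$ is the Euclidean norm. Points $x_1, \ldots, x_N \in \mathbb{S}_n$ are called random points if they are distributed independently and uniformly in $\mathbb{S}_n$. The set $B_X$ is, with probability $1$, the closed unit ball of a norm $\|\cdot\|_X$ on $\mathbb{R}^n$; $\|P\|_X$ denotes the operator norm of $P: X \to X$ with respect to this norm. A projection is a linear continuous map $P: X \to X$ with $P^2 = P$; a hyperplane projection is a projection whose image has codimension $1$. *)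

(* Defs.v *)
From HB Require Import structures.
From mathcomp Require Import all_boot all_order all_algebra.
From mathcomp Require Import all_classical all_reals all_analysis.

Set Implicit Arguments.
Unset Strict Implicit.
Unset Printing Implicit Defensive.

Import Order.TTheory GRing.Theory Num.Theory.
Import numFieldNormedType.Exports.

Local Open Scope classical_set_scope.
Local Open Scope ring_scope.

(* The library norm on row vectors is the sup norm, hence this definition. *)
Definition euclidean_norm (R : realType) (n : nat) (x : 'rV[R]_n) : R :=
  Num.sqrt (\sum_(j < n) x ord0 j ^+ 2).

Definition unit_sphere (R : realType) (n : nat) : set 'rV[R]_n :=
  [set x | euclidean_norm x = 1].

(* R^n with its Borel sigma-algebra. *)
Definition borel_rV (R : realType) (n : nat) : measurableType _ :=
  g_sigma_algebraType (@open 'rV[R]_n).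

(* The uniform distribution on the sphere is the unique rotation-invariant
   Borel probability measure carried by it (the normalized surface measure). *)
Definition uniform_on_sphere (R : realType) (n : nat)
    (mu : probability (borel_rV R n) R) : Prop :=
  mu (@unit_sphere R n) = 1%E /\
  forall (U : 'M[R]_n) (A : set (borel_rV R n)),
    U *m U^T = 1%:M -> measurable A ->
    mu ((fun x : 'rV[R]_n => x *m U) @^-1` A) = mu A.

Definition mutually_independent (d d' : measure_display)
    (T : measurableType d) (T' : measurableType d') (R : realType)
    (P : probability T R) (I : finType) (X : I -> {RV P >-> T'}) : Prop :=
  forall (J : {set I}) (A : I -> set T'),
    (forall i, i \in J -> measurable (A i)) ->
    P (\bigcap_(i in [set i | i \in J]) (X i @^-1` A i)) =
    (\prod_(i in J) P (X i @^-1` A i))%E.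

Definition random_points (d : measure_display) (T : measurableType d)
    (R : realType) (P : probability T R) (n N : nat)
    (X : 'I_N -> {RV P >-> borel_rV R n}) : Prop :=
  mutually_independent X /\
  forall i, uniform_on_sphere (distribution P (X i)).

Definition convex_hull (R : realType) (V : lmodType R) (A : set V) : set V :=
  smallest (@convex_set R V) A.

Definition symmetric_hull (R : realType) (n N : nat) (x : 'I_N -> 'rV[R]_n) :
    set 'rV[R]_n :=
  convex_hull [set y | exists i, y = x i \/ y = - x i].

Record is_norm (R : realType) (V : lmodType R) (nu : V -> R) : Prop := IsNorm {
  norm_definite : forall x, nu x = 0 -> x = 0;
  norm_homogeneous : forall (a : R) x, nu (a *: x) = `|a| * nu x;
  norm_triangle : forall x y, nu (x + y) <= nu x + nu y }.

Definition operator_norm (R : realType) (n : nat) (nu : 'rV[R]_n -> R)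
    (P : 'End('rV[R]_n)) : R :=
  sup [set nu (P x) | x in [set x | nu x <= 1]].

(* Linear maps of R^n are automatically continuous for every norm. *)
Definition hyperplane_projection (R : realType) (n : nat)
    (P : 'End('rV[R]_n)) : Prop :=
  (P \o P)%VF = P /\ (\dim (limg P)).+1 = n.

(* Natural-number subtraction is exact here as soon as 2 <= n. *)
Definition c_ (R : realType) (n : nat) : R :=
  n%:R ^+ (2 * n ^ 2 + 7 * n - 11) / expR 1 ^+ (2 * n ^ 2 + 7 * n + 3).

(* B is the closed unit ball of a norm (which B then determines), and for this
   norm every hyperplane projection has operator norm at least r. *)
Definition hyperplane_projections_ge (R : realType) (n : nat)
    (B : set 'rV[R]_n) (r : R) : Prop :=
  exists nu : 'rV[R]_n -> R,
    [/\ is_norm nu, B = [set x | nu x <= 1] &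
        forall P : 'End('rV[R]_n),
          hyperplane_projection P -> r <= operator_norm nu P].

(* Main.v *)
(* Write a hyperplane projection as P x = x - f(x) v with f(v) = 1 and |f| = 1,
   and suppose that ||P|| <= 1 + eps. Let F be a facet with normal phi (phi = 1 on
   F) and vertices y_k. From psi(P y_k) <= 1 + eps for a functional psi of norm 1
   with psi(y_k) = 1 one gets - f(y_k) psi(v) <= eps, so psi(v) is nearly 0 as soon
   as f takes substantial values of both signs at vertices where psi = 1. This
   applies to phi, and also to phi - eta e_k, where e_k are the coordinates in the
   basis (y_k), provided all the points off F are at a distance from its
   hyperplane. Since F has at least three vertices, all the coordinates e_k(v) but
   one, and then all of them, are nearly 0, which contradicts f(v) = 1.

   It remains to find a facet F crossed by ker f on whose vertices f is not nearly
   0. At most n - 1 points are nearly zeros of f, so some unit vector u of ker f is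
   at an angle of about 45 degrees at least to all of them; if the points form a
   net of the sphere, the facet in the direction u is small and misses them.

   The configuration has to avoid three events of probability at most 1 / N each:
   the points are not a net; some point is too close to the span of n - 1 others;
   some point is too close to the affine hyperplane through n others (up to signs).
   For the last two, a thin slab has small measure: rotate it into many slabs no
   three of which have a common point. *)

From HB Require Import structures.
From mathcomp Require Import all_boot all_order all_algebra.
From mathcomp Require Import ring lra zify.
Require Import Defs.

Set Implicit Arguments.
Unset Strict Implicit.
Unset Printing Implicit Defensive.

Import Order.TTheory GRing.Theory Num.Theory.

Local Open Scope ring_scope.

(** * Inner product and coordinates *)

(** The probabilistic part tests one random point at a time against a hyperplane built from
    independent points. Coordinates and facet normals are therefore written without division, with
    cofactors, so that they are polynomial in the other points and the tested point enters through a
    single inner product. A slab of half-width [delta] gets a bound of order [sqrt delta]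
    (probability [2 n / M] as soon as [64 n delta^2 M^4 < 1]). Union bounds over about [N^n] and
    [N^(n+1)] choices thus allow margins of order [N^-(2n+2)] for [delta] and [N^-(2n+4)] for
    [gamma]. The contradiction needs [eps < delta^2 gamma / (4 n^2)], of order [N^-(6n+8)]; the
    surplus in the exponent of [N] absorbs all powers of [n] because [N >= n^(4n)]. Measurability of
    the event has to be proved too, although the event quantifies over all norms and projections. A
    projection of norm less than [r] is witnessed by a coefficient matrix with finitely many strict
    inequalities, and the witness survives small perturbations; the event is a difference of two
    open conditions on the configuration. *)

Section DotProduct.
Variables (R : realFieldType) (n : nat).
Implicit Types u v w : 'rV[R]_n.

Definition dot u v : R := \sum_j u ord0 j * v ord0 j.

Lemma dotC u v : dot u v = dot v u.
Proof. by apply: eq_bigr => j _; rewrite mulrC. Qed.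

Lemma dotDl u v w : dot (u + v) w = dot u w + dot v w.
Proof. by rewrite -big_split; apply: eq_bigr => j _; rewrite !mxE mulrDl. Qed.

Lemma dotZl a u v : dot (a *: u) v = a * dot u v.
Proof. by rewrite mulr_sumr; apply: eq_bigr => j _; rewrite !mxE mulrA. Qed.

Lemma dotNl u v : dot (- u) v = - dot u v.
Proof. by rewrite -scaleN1r dotZl mulN1r. Qed.

Lemma dotBl u v w : dot (u - v) w = dot u w - dot v w.
Proof. by rewrite dotDl dotNl. Qed.

Lemma dotDr u v w : dot w (u + v) = dot w u + dot w v.
Proof. by rewrite !(dotC w) dotDl. Qed.

Lemma dotZr a u v : dot v (a *: u) = a * dot v u.
Proof. by rewrite !(dotC v) dotZl. Qed.

Lemma dotNr u v : dot v (- u) = - dot v u.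
Proof. by rewrite !(dotC v) dotNl. Qed.

Lemma dotBr u v w : dot w (u - v) = dot w u - dot w v.
Proof. by rewrite !(dotC w) dotBl. Qed.

Lemma dot0l u : dot 0 u = 0.
Proof. by rewrite -(scale0r u) dotZl mul0r. Qed.

Lemma dot0r u : dot u 0 = 0.
Proof. by rewrite dotC dot0l. Qed.

Lemma dot_suml (I : finType) (F : I -> 'rV[R]_n) u :
  dot (\sum_i F i) u = \sum_i dot (F i) u.
Proof.
by apply: (big_morph (fun x => dot x u)) => [x y|]; rewrite ?dotDl ?dot0l.
Qed.

Lemma dot_mulmx m (c : 'rV[R]_m) (A : 'M[R]_(m, n)) u :
  dot (c *m A) u = \sum_k c ord0 k * dot (row k A) u.
Proof.
rewrite mulmx_sum_row dot_suml.
by apply: eq_bigr => k _; rewrite dotZl.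
Qed.

Lemma dot_ge0 u : 0 <= dot u u.
Proof. by apply: sumr_ge0 => j _; rewrite -expr2 sqr_ge0. Qed.

Lemma dot_eq0 u : (dot u u == 0) = (u == 0).
Proof.
apply/eqP/eqP => [u0|->]; last exact: dot0l.
apply/rowP => j; rewrite mxE; apply/eqP.
rewrite -sqrf_eq0 expr2; apply/eqP; move: j (erefl true).
by apply: psumr_eq0P u0 => j _; rewrite -expr2 sqr_ge0.
Qed.

Lemma cauchy_schwarz u v : dot u v ^+ 2 <= dot u u * dot v v.
Proof.
have [->|v0] := eqVneq v 0; first by rewrite !dot0r mulr0 expr0n.
have vv : 0 < dot v v by rewrite lt_neqAle eq_sym dot_eq0 v0 dot_ge0.
have e : dot (dot v v *: u - dot u v *: v) (dot v v *: u - dot u v *: v) =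
    dot v v * (dot u u * dot v v - dot u v ^+ 2).
  by rewrite !(dotBl, dotBr, dotZl, dotZr) (dotC v u); ring.
by have := dot_ge0 (dot v v *: u - dot u v *: v); rewrite e pmulr_rge0 // subr_ge0.
Qed.

Lemma dot_gt0 u : (0 < dot u u) = (u != 0).
Proof. by rewrite lt_neqAle eq_sym dot_eq0 dot_ge0 andbT. Qed.

Lemma triangle_sqr u v : dot (u + v) (u + v) <= 2 * (dot u u + dot v v).
Proof.
have := dot_ge0 (u - v).
have -> : dot (u - v) (u - v) =
    2 * (dot u u + dot v v) - dot (u + v) (u + v).
  by rewrite !(dotBl, dotBr, dotDl, dotDr) (dotC v u); ring.
by rewrite subr_ge0.
Qed.

(* Up to the factor [\det A], the functional giving the [k]-th coordinate in the
   basis of the rows of [A]; it depends on the other rows only. *)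
Definition cofactor_row (A : 'M[R]_n) (k : 'I_n) : 'rV[R]_n :=
  \row_j cofactor A k j.

Lemma dot_cofactor_row (A : 'M[R]_n) k : dot (row k A) (cofactor_row A k) = \det A.
Proof. by rewrite (expand_det_row A k); apply: eq_bigr => j _; rewrite !mxE. Qed.

Lemma coordE (A : 'M[R]_n) u k : A \in unitmx ->
  (u *m invmx A) ord0 k = dot u (cofactor_row A k) / \det A.
Proof.
move=> uA; rewrite /invmx uA -scalemxAr mxE mulrC mxE; congr (_ / _).
by apply: eq_bigr => j _; rewrite !mxE.
Qed.

Lemma coord_sum (A : 'M[R]_n) u : A \in unitmx ->
  u = \sum_k (u *m invmx A) ord0 k *: row k A.
Proof. by move=> uA; rewrite -mulmx_sum_row mulmxKV. Qed.

Lemma dual_vector (A : 'M[R]_n) (s : 'I_n -> R) : A \in unitmx ->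
  exists phi, forall k, dot phi (row k A) = s k.
Proof.
move=> uA; exists (invmx A *m \col_k s k)^T => k.
transitivity ((A *m (invmx A *m \col_k s k)) k ord0); last first.
  by rewrite mulKVmx // mxE.
by rewrite mxE; apply: eq_bigr => j _; rewrite !mxE mulrC.
Qed.

Lemma dot_coord (A : 'M[R]_n) u v : A \in unitmx ->
  dot v u = \sum_k (u *m invmx A) ord0 k * dot v (row k A).
Proof.
move=> uA; rewrite {1}(coord_sum u uA) dotC dot_suml.
by apply: eq_bigr => k _; rewrite dotZl dotC.
Qed.

Lemma avoid_small (bad : seq R) (s : R) : 0 < s ->
  exists2 t0, 0 < t0 <= s & forall t, 0 < t <= t0 -> t \notin bad.
Proof.
move=> s0; elim: bad => [|b bad [t0 /andP[t00 t0s] ht]].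
  by exists s => //; rewrite s0 lexx.
have [b0|b0] := ltrP 0 b; last first.
  exists t0 => [|t /andP[t_gt0 tt0]]; first by rewrite t00.
  by rewrite inE negb_or ht ?t_gt0 // gt_eqF // (le_lt_trans b0).
exists (Num.min t0 (b / 2)) => [|t /andP[t_gt0]].
  by rewrite lt_min t00 divr_gt0 //= ge_min t0s.
rewrite le_min => /andP[tt0 tb].
by rewrite inE negb_or ht ?t_gt0 // lt_eqF // (le_lt_trans tb) // gtr_pMr // invf_lt1 // ltr1n.
Qed.

(** Along the line [w + t *: h], each [g] with [dot h g != 0] excludes a single value of [t], and
    every other [g] keeps the value it has at [w]. *)
Lemma nonvanishing_vector (hs : seq 'rV[R]_n) : 0 \notin hs ->
  exists w, forall h, h \in hs -> dot w h != 0.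
Proof.
elim: hs => [_|h hs IH]; first by exists 0.
rewrite inE negb_or eq_sym => /andP[h0 /IH[w hw]].
pose bad := [seq - (dot w g / dot h g) | g <- h :: hs].
have [t /andP[t0 _] /(_ t)] := avoid_small bad (@ltr01 R).
rewrite t0 lexx => /(_ erefl) tbad; exists (w + t *: h) => g.
move=> gh; apply/eqP; rewrite dotDl dotZl => /eqP; rewrite addr_eq0 => /eqP wg.
have [hg|hg] := eqVneq (dot h g) 0.
  move: gh; rewrite inE => /orP[/eqP ge|/hw]; last by rewrite wg hg mulr0 oppr0 eqxx.
  by move/eqP: hg; rewrite ge dot_eq0 (negbTE h0).
move/negP: tbad; apply; apply/mapP; exists g => //.
by rewrite wg mulNr mulfK // opprK.
Qed.

Lemma generic_perturbation (hs : seq 'rV[R]_n) u (k : R) : 0 \notin hs ->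
  0 < k -> exists2 y, dot (y - u) (y - u) <= k & forall h, h \in hs -> dot y h != 0.
Proof.
move=> /nonvanishing_vector[w hw] k0.
(* From [t <= 1] and [t * (1 + dot w w) <= k] the squared displacement [t ^+ 2 * dot w w] is at most
   [k]; the summand 1 keeps the denominator positive. *)
pose s := Num.min 1 (k / (1 + dot w w)).
have w1 : 0 < 1 + dot w w by rewrite ltr_pwDl // dot_ge0.
have s0 : 0 < s by rewrite lt_min ltr01 divr_gt0.
pose bad := [seq - (dot u g / dot w g) | g <- hs].
have [t /andP[t0 ts] /(_ t)] := avoid_small bad s0.
rewrite t0 lexx => /(_ erefl) tbad; exists (u + t *: w) => [|g gh]; last first.
  apply/eqP; rewrite dotDl dotZl => /eqP; rewrite addr_eq0 => /eqP wg.
  move/negP: tbad; apply; apply/mapP; exists g => //.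
  by rewrite wg mulNr mulfK ?opprK // hw.
rewrite addrAC subrr add0r dotZl dotZr.
move: ts; rewrite le_min => /andP[t1]; rewrite ler_pdivlMr // => tk.
apply: le_trans tk; rewrite ler_pM2l //.
have : t * dot w w <= dot w w by rewrite ler_piMl // dot_ge0.
by move=> /le_trans; apply; rewrite lerDr.
Qed.

Lemma orthogonal_vector (s : seq 'rV[R]_n) : (size s < n)%N ->
  exists2 u, u != 0 & forall z, z \in s -> dot u z = 0.
Proof.
move=> sn; pose A := \matrix_(i < size s) s`_i.
have : kermx A^T != 0.
  rewrite kermx_eq0 /row_free neq_ltn (leq_ltn_trans _ sn) //.
  by rewrite mxrank_tr rank_leq_row.
move=> /rowV0Pn[u /sub_kermxP uA u0]; exists u => // z zs.
have iz : (index z s < size s)%N by rewrite index_mem.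
move/matrixP/(_ ord0 (Ordinal iz)): uA; rewrite !mxE => <-.
by apply: eq_bigr => j _; rewrite !mxE nth_index.
Qed.

End DotProduct.

(** * Facets of the symmetric hull *)

Section Facet.
Variables (R : realFieldType) (n N : nat) (X : 'M[R]_(N, n)).

(* The simplex method without pivoting: the basis with the least l1 norm of the
   coordinates of [y] spans a facet, since any point beyond its hyperplane could
   enter the basis and lower that norm. As no coordinate of [y] vanishes, the
   exchange cannot be degenerate. *)
Lemma facet_through (y : 'rV[R]_n) : (n <= N)%N ->
  (forall i : 'I_n -> 'I_N, injective i -> rowsub i X \in unitmx) ->
  (forall (i : 'I_n -> 'I_N) k, injective i ->
     (y *m invmx (rowsub i X)) ord0 k != 0) ->
  exists (i : 'I_n -> 'I_N) (phi : 'rV[R]_n), [/\ injective i,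
    forall k, dot phi (row (i k) X) = Num.sg ((y *m invmx (rowsub i X)) ord0 k) &
    forall j, `|dot phi (row j X)| <= 1].
Proof.
move=> nN uX gen.
pose c (i : {ffun 'I_n -> 'I_N}) := y *m invmx (rowsub i X).
pose F i : R := \sum_k `|c i ord0 k|.
pose i0 : {ffun 'I_n -> 'I_N} := [ffun k => widen_ord nN k].
have i0_inj : injectiveb i0.
  by apply/injectiveP => a b; rewrite !ffunE => /(congr1 val) /= /val_inj.
have [i /injectiveP iI imin] := @arg_minP _ _ _ i0 (fun i => injectiveb i) F i0_inj.
have uA := uX _ iI; set A := rowsub i X in uA.
have [phi phiE] := dual_vector (fun k => Num.sg (c i ord0 k)) uA.
have phiE' k : dot phi (row (i k) X) = Num.sg (c i ord0 k).
  by rewrite -phiE row_rowsub.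
exists i, phi; split=> // j.
rewrite leNgt; apply/negP => phij.
pose sj := Num.sg (dot phi (row j X)).
pose t := row j X *m invmx A.
(* [T k] is the rate at which [|c i k|] decreases when the point [j] enters the basis with a
   coefficient of sign [sj]. The rates add up to [|dot phi (row j X)|], which exceeds the rate 1 at
   which the new coefficient grows. *)
pose T k := sj * Num.sg (c i ord0 k) * t ord0 k.
have sj1 : `|sj| = 1.
  by rewrite normr_sg; case: eqP phij => // ->; rewrite normr0 ltr10.
have sgc k : `|Num.sg (c i ord0 k)| = 1 by rewrite normr_sg gen.
have sumT : 1 < \sum_k T k.
  suff e : \sum_k T k = `|dot phi (row j X)|.
    by rewrite e.
  rewrite [RHS]normrEsg -/sj (dot_coord _ _ uA) mulr_sumr.
  by apply: eq_bigr => k _; rewrite phiE /T -mulrA [_ * t _ _]mulrC.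
have c_gt0 k : 0 < `|c i ord0 k| by rewrite normr_gt0 gen.
have [m0 m0T] : exists m, 0 < T m.
  apply/existsP; apply: contraLR sumT; rewrite negb_exists -leNgt => /forallP h.
  by apply: (le_trans _ ler01); apply: sumr_le0 => k _; rewrite leNgt.
(* The ratio test of the simplex method: [m] is the first coordinate to reach 0, and it leaves the
   basis. *)
have [m mT mmin] := @arg_minP _ _ _ m0 (fun m => 0 < T m)
  (fun m => `|c i ord0 m| / T m) m0T.
pose s := `|c i ord0 m| / T m.
have s_gt0 : 0 < s by rewrite divr_gt0.
have le_sT k : s * T k <= `|c i ord0 k|.
  have [Tk|Tk] := ltrP 0 (T k); first by rewrite -ler_pdivlMr ?mmin.
  by apply: le_trans (normr_ge0 _); rewrite pmulr_rle0.
have i_neq k : i k != j.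
  apply/eqP => ikj; move: phij; rewrite -ikj phiE' normr_sg gen //.
  by rewrite ltxx.
pose i' : {ffun 'I_n -> 'I_N} := [ffun k => if k == m then j else i k].
have i'I : injective i'.
  move=> a b; rewrite !ffunE; case: eqP => [->|_]; case: eqP => [->|_] //.
  - by move/esym/eqP; rewrite (negbTE (i_neq _)).
  - by move/eqP; rewrite (negbTE (i_neq _)).
  - exact: iI.
pose c' : 'rV[R]_n := \row_k (if k == m then sj * s else c i ord0 k - s * sj * t ord0 k).
have c'E k : c' ord0 k = if k == m then sj * s else c i ord0 k - s * sj * t ord0 k.
  by rewrite mxE.
have cE : c i' = c'.
  apply: (@can_inj _ _ _ _ (mulmxK (uX _ i'I))).
  have xj : row j X = \sum_k t ord0 k *: row k A := coord_sum _ uA.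
  have sTm : s * sj * t ord0 m = c i ord0 m.
    have sTm : s * T m = `|c i ord0 m| by rewrite divfK // gt_eqF.
    have sg2 : Num.sg (c i ord0 m) ^+ 2 = 1 by rewrite sqr_sg gen.
    rewrite [RHS]numEsg -sTm /T.
    transitivity (Num.sg (c i ord0 m) ^+ 2 * (s * sj * t ord0 m)).
      by rewrite sg2 mul1r.
    ring.
  transitivity (\sum_k c i ord0 k *: row k A).
    by rewrite [LHS]mulmxKV ?uX //; exact: coord_sum.
  rewrite [RHS]mulmx_sum_row.
  rewrite [RHS](bigD1 m) //= row_rowsub ffunE c'E eqxx xj [LHS](bigD1 m) //=.
  rewrite scaler_sumr [X in _ = X + _](bigD1 m) //= -addrA -big_split /=.
  congr (_ + _); first by rewrite scalerA -sTm [sj * s]mulrC.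
  apply: eq_bigr => k km.
  rewrite !row_rowsub ffunE c'E (negbTE km) scalerA -scalerDl.
  by congr (_ *: _); ring.
have [i'i|] := boolP (injectiveb i'); last by move/injectiveP: i'I => ->.
have := imin _ i'i; rewrite leNgt => /negP; apply.
rewrite /F cE (bigD1 m) //= c'E eqxx normrM sj1 mul1r gtr0_norm //.
rewrite (eq_bigr (fun k => `|c i ord0 k| - s * T k)) => [|k km]; last first.
  rewrite c'E (negbTE km).
  have -> : `|c i ord0 k| - s * T k = `| `|c i ord0 k| - s * T k |.
    by rewrite [RHS]ger0_norm // subr_ge0.
  rewrite -[LHS]mul1r -(sgc k) -normrM mulrBr -normrEsg; congr `|_ - _|.
  by rewrite /T; ring.
(* The summand at [m] is 0, since [s * T m] is [|c i m|]; adding it back makes the sum range over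
   all [k]. *)
have -> : s + \sum_(k | k != m) (`|c i ord0 k| - s * T k) =
    s + \sum_k (`|c i ord0 k| - s * T k).
  rewrite [in RHS](bigD1 m) //= divfK ?gt_eqF // subrr add0r //.
rewrite sumrB -mulr_sumr addrCA -/(F i) gtrDl subr_lt0.
by rewrite -[ltLHS]mulr1 ltr_pM2l.
Qed.
End Facet.

(** * Unit vectors under orthogonality constraints *)

Section UnitVectors.
Variables (R : rcfType) (n : nat).
Implicit Types u v w : 'rV[R]_n.

Lemma normalize u : u != 0 ->
  dot ((Num.sqrt (dot u u))^-1 *: u) ((Num.sqrt (dot u u))^-1 *: u) = 1.
Proof.
rewrite -dot_eq0 => u0; rewrite dotZl dotZr mulrA -invfM -expr2 sqr_sqrtr ?dot_ge0 //.
by rewrite mulVf.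
Qed.

Lemma ler_dot u v (s : R) : 0 <= s -> dot u u * dot v v <= s ^+ 2 -> `|dot u v| <= s.
Proof.
move=> s0 uvs; rewrite -(ger0_norm s0) -ler_sqr ?nnegrE // !real_normK ?num_real //.
exact: le_trans (cauchy_schwarz u v) uvs.
Qed.

Lemma dot_unit_le1 u v : dot u u = 1 -> dot v v = 1 -> `|dot u v| <= 1.
Proof. by move=> u1 v1; apply: ler_dot; rewrite ?u1 ?v1 ?ler01 // expr2. Qed.

Lemma orthogonal_unit_vector (s : seq 'rV[R]_n) : (size s < n)%N ->
  exists2 u, dot u u = 1 & forall z, z \in s -> dot u z = 0.
Proof.
move=> /orthogonal_vector[u u0 us].
exists ((Num.sqrt (dot u u))^-1 *: u) => [|z zs]; first exact: normalize.
by rewrite dotZl (us z) ?mulr0.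
Qed.

Lemma bessel2 u1 u2 z : dot u1 u1 = 1 -> dot u2 u2 = 1 -> dot u1 u2 = 0 ->
  dot u1 z ^+ 2 + dot u2 z ^+ 2 <= dot z z.
Proof.
move=> u11 u22 u12; rewrite -subr_ge0.
set p := dot u1 z; set q := dot u2 z.
have := dot_ge0 (z - p *: u1 - q *: u2).
rewrite !(dotBl, dotBr, dotZl, dotZr) u11 u22 (dotC u2 u1) u12 !(dotC z) -/p -/q.
by congr (0 <= _); ring.
Qed.

(** With at most [n - 2] vectors in [s], [u] can be orthogonal to [f] and to all of them. With
    [n - 1] there is one constraint too many, so two vectors [z] and [z'] share the loss: [u1] gives
    up [z'], [u2] gives up both but is orthogonal to [u1], and [u] is [u1 + e *: u2] normalized.
    Against [z] only [u2] contributes; against [z'] the sign [e] makes the cross term nonpositive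
    and Bessel's inequality bounds the rest. *)
Lemma balanced_unit_vector f (s : seq 'rV[R]_n) : (2 < n)%N -> (size s < n)%N ->
  (forall z, z \in s -> dot z z <= 1) ->
  exists u, [/\ dot u u = 1, dot u f = 0 &
    forall z, z \in s -> dot u z ^+ 2 <= 1 / 2].
Proof.
move=> n3 sn s1.
have half0 : 0 <= 1 / 2 :> R by rewrite divr_ge0.
have [sn1|ns1] := ltnP (size s).+1 n.
  have [u u1 us] := @orthogonal_unit_vector (f :: s) sn1.
  exists u; split=> // [|z zs]; first by rewrite us ?mem_head.
  by rewrite us ?expr0n // inE zs orbT.
case: s => [|z [|z' s]] /= in sn s1 ns1 *.
- by rewrite leqNgt (leq_trans _ n3) in ns1.
- by rewrite leqNgt n3 in ns1.
have [u1 u11 hu1] := @orthogonal_unit_vector [:: f, z & s] sn.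
have [u2 u22 hu2] := @orthogonal_unit_vector [:: f, u1 & s] sn.
have u12 : dot u1 u2 = 0 by rewrite dotC hu2 // !inE eqxx orbT.
have hs i : i \in s -> dot u1 i = 0 /\ dot u2 i = 0.
  by move=> iS; rewrite hu1 ?hu2 // !inE iS !orbT.
pose h : R := (Num.sqrt 2)^-1.
have h2 : h ^+ 2 = 1 / 2 by rewrite exprVn sqr_sqrtr // div1r.
have half_le (a : R) : a ^+ 2 <= 1 -> (h * a) ^+ 2 <= 1 / 2.
  by rewrite exprMn h2 => a1; rewrite -[leRHS]mulr1 ler_wpM2l.
have [e [e2 ez']] : exists e : R, e ^+ 2 = 1 /\ (dot u1 z' + e * dot u2 z') ^+ 2 <= 1.
  have := le_trans (bessel2 z' u11 u22 u12) (s1 z' _).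
  rewrite !inE eqxx orbT => /(_ erefl).
  move: (dot u1 z') (dot u2 z') => p q pq.
  have [pq0|pq0] := lerP (p * q) 0; [exists 1|exists (-1)]; split; lra.
exists (h *: (u1 + e *: u2)); split => [||i].
- rewrite !(dotZl, dotZr, dotDl, dotDr) u11 u22 (dotC u2) u12.
  transitivity (h ^+ 2 * (1 + e ^+ 2)); first by ring.
  by rewrite h2 e2; field.
- by rewrite dotZl dotDl dotZl hu1 ?hu2 ?mem_head // !mulr0 addr0 mulr0.
rewrite !inE => /or3P[/eqP->|/eqP->|iS]; rewrite dotZl dotDl dotZl.
- apply: half_le; rewrite hu1 ?inE ?eqxx ?orbT // add0r exprMn e2 mul1r.
  apply: le_trans (cauchy_schwarz _ _) _.
  by rewrite u22 mul1r s1 // mem_head.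
- exact: half_le.
- by have [-> ->] := hs i iS; rewrite mulr0 addr0 mulr0 expr0n.
Qed.

End UnitVectors.

(** * Configurations without good projections *)

Section Deterministic.
Variables (R : rcfType) (n N : nat) (X : 'M[R]_(N, n)) (delta gamma : R).
Hypothesis n3 : (2 < n)%N.
Hypothesis nN : (n <= N)%N.
Hypothesis unitX : forall i, dot (row i X) (row i X) = 1.
Hypothesis netX : forall w, dot w w = 1 ->
  exists i, 19 / 20 <= `|dot w (row i X)|.
Hypothesis basisX : forall i : 'I_n -> 'I_N, injective i -> rowsub i X \in unitmx.
Hypothesis coordX : forall (i : 'I_n -> 'I_N) k y, injective i -> dot y y <= 1 ->
  delta * `|(y *m invmx (rowsub i X)) ord0 k| <= 1.
Hypothesis gapX : forall (i : 'I_n -> 'I_N) phi j, injective i ->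
  (forall k, `|dot phi (row (i k) X)| = 1) -> (forall k, i k != j) ->
  gamma <= `| `|dot phi (row j X)| - 1|.
Hypothesis delta01 : 0 < delta <= 1.
Hypothesis gamma01 : 0 < gamma <= 1.

(** The polar body of the symmetric hull, that is, the unit ball of the dual norm. *)
Definition feasible phi := forall i, `|dot phi (row i X)| <= 1.

(** Some point of the net is nearly aligned with [phi] up to sign and sees at least 19/20 of its
    length, while [phi] is at most 1 there. *)
Lemma feasible_norm phi : feasible phi -> dot phi phi <= (20 / 19) ^+ 2.
Proof.
move=> fphi; have [->|phi0] := eqVneq phi 0; first by rewrite dot0l sqr_ge0.
have [i] := netX (normalize phi0); rewrite dotZl normrM.
have s0 : 0 < Num.sqrt (dot phi phi) by rewrite sqrtr_gt0 dot_gt0.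
rewrite gtr0_norm ?invr_gt0 // ler_pdivlMl // => h.
rewrite -[leLHS]sqr_sqrtr ?dot_ge0 // ler_sqr ?nnegrE ?sqrtr_ge0 //.
  by have := le_trans h (fphi i); lra.
by lra.
Qed.

Definition nearly_zero (f : 'rV[R]_n) := [set i | `|dot (row i X) f| < delta / n%:R].

(** Otherwise [n] of them form a basis in which the coordinates of [f] are at most [1 / delta], and
    expanding [dot f f] gives less than [n * (1 / delta) * (delta / n) = 1]. This is the origin of
    the threshold [delta / n]. *)
Lemma card_nearly_zero f : dot f f = 1 -> (#|nearly_zero f| < n)%N.
Proof.
move=> f1; rewrite ltnNge; apply/negP => nZ.
pose i (k : 'I_n) : 'I_N := enum_val (widen_ord nZ k).
have iI : injective i by move=> a b /enum_val_inj /(congr1 val) /= /val_inj.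
have := ltxx (1 : R); rewrite -{1}f1 (dot_coord f f (basisX iI)).
move=> /negP; apply; apply: le_lt_trans (ler_norm _) _.
apply: le_lt_trans (ler_norm_sum _ _ _) _.
have n0 : (0 < n)%N by exact: leq_trans n3.
have -> : 1 = \sum_(k < n) n%:R^-1 :> R.
  by rewrite sumr_const card_ord -[_^-1 *+ n]mulr_natr mulVf // pnatr_eq0 -lt0n.
apply: ltr_sum => [|k _]; first by apply/hasP; exists (Ordinal n0); rewrite ?mem_index_enum.
rewrite normrM row_rowsub dotC.
have := enum_valP (widen_ord nZ k); rewrite inE -/(i k) => fk.
have := coordX k iI (_ : dot f f <= 1); rewrite f1 lexx => /(_ erefl).
set c := `|_|; move/andP: delta01 => [d0 d1] dc.
rewrite -[ltLHS]mul1r -[X in X * _](mulVf (lt0r_neq0 d0)) -!mulrA ltr_pdivrMl //.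
apply: le_lt_trans fk; rewrite mulrA ler_piMl //.
Qed.

(* A facet meeting the ray of [y] is thin because its normal is short, so its
   vertices lie close to [u]. *)
Lemma facet_vertex_near u y phi z kappa : dot u u = 1 -> 0 <= kappa <= 1 / 100 ->
  dot (y - u) (y - u) <= kappa ^+ 2 -> feasible phi -> 1 - kappa <= dot phi y ->
  dot z z = 1 -> dot phi z = 1 -> 1 / 2 < dot u z ^+ 2.
Proof.
move=> u1 /andP[k0 k1] yu fphi phiy z1 phiz.
have pp := feasible_norm fphi.
have phiyu : `|dot phi (y - u)| <= 20 / 19 * kappa.
  apply: ler_dot; first by apply: mulr_ge0 => //; lra.
  by rewrite exprMn ler_pM // dot_ge0.
have phiu : 1 - 3 * kappa <= dot phi u.
  have e : dot phi u = dot phi y - dot phi (y - u) by rewrite dotBr; ring.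
  have := ler_norm (dot phi (y - u)); rewrite e.
  by move: phiyu phiy; move: (dot phi y) (dot _ _) `|_| => a b c; lra.
(* [phi] serves as a point midway between [z] and [u]: it has length close to 1 and nearly unit
   inner product with both. The resulting bound 71/100 on [dot u z] just exceeds [1 / sqrt 2]. *)
have := triangle_sqr (z - phi) (phi - u).
have -> : z - phi + (phi - u) = z - u by rewrite addrA subrK.
have -> : dot (z - phi) (z - phi) = dot phi phi - 1.
  by rewrite !(dotBl, dotBr) (dotC z) z1 phiz; ring.
have -> : dot (phi - u) (phi - u) = dot phi phi - 2 * dot phi u + 1.
  by rewrite !(dotBl, dotBr) (dotC u) u1; ring.
have -> : dot (z - u) (z - u) = 2 - 2 * dot u z.
  by rewrite !(dotBl, dotBr) (dotC z u) u1 z1; ring.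
move: pp phiu; move: (dot phi phi) (dot phi u) (dot u z) => a b c pp phiu h.
have c7 : 71 / 100 <= c by lra.
have : (71 / 100) ^+ 2 <= c ^+ 2 by rewrite ler_sqr ?nnegrE //; lra.
by lra.
Qed.

(** The coordinates vanish on finitely many hyperplanes, whose normals are the cofactor rows; these
    are nonzero because the bases are invertible. *)
Lemma generic_near u (kappa : R) : 0 < kappa ->
  exists2 y, dot (y - u) (y - u) <= kappa ^+ 2 &
    forall (i : 'I_n -> 'I_N) k, injective i ->
      (y *m invmx (rowsub i X)) ord0 k != 0.
Proof.
move=> k0.
pose I := {ffun 'I_n -> 'I_N}.
pose hs := [seq cofactor_row (rowsub p.1 X) p.2 |
  p : I * 'I_n <- enum {: I * 'I_n} & injectiveb p.1].
have rowsubE (i : 'I_n -> 'I_N) : rowsub [ffun k => i k] X = rowsub i X.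
  by apply/matrixP => a b; rewrite !mxE ffunE.
have hs0 : 0 \notin hs.
  apply/mapP => -[[i k]]; rewrite mem_filter /= => /andP[/injectiveP iI _] w0.
  have := basisX iI; rewrite unitmxE -(dot_cofactor_row _ k) -w0.
  by rewrite dot0r unitr0.
have [y yu yhs] := generic_perturbation u hs0 (exprn_gt0 2 k0).
exists y => // i k iI; rewrite coordE ?basisX // mulf_neq0 //; last first.
  by rewrite invr_eq0 -unitfE -unitmxE basisX.
apply: yhs; apply/mapP; exists ([ffun k => i k], k); last by rewrite /= rowsubE.
rewrite mem_filter mem_enum andbT /=.
by apply/injectiveP => a b; rewrite !ffunE => /iI.
Qed.

Lemma third_index (j l : 'I_n) : exists m, (m != j) && (m != l).
Proof.
apply/existsP; apply: contraLR n3; rewrite negb_exists -leqNgt => /forallP h.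
rewrite -[leqLHS]card_ord; apply: leq_trans (_ : #|[set j; l]| <= 2)%N.
  apply: subset_leq_card; apply/subsetP => m _; rewrite !inE.
  by have := h m; rewrite negb_and !negbK.
by rewrite cards2; case: (_ != _).
Qed.

(* Here [F k] is the value of [f] at the [k]-th vertex of a facet. *)
Lemma mixed_signs_but_one (F : 'I_n -> R) (tau : R) j l : 0 < tau ->
  (forall k, tau <= `|F k|) -> 0 < F j -> F l < 0 ->
  exists k0, forall k, k != k0 ->
    (exists2 a, a != k & tau <= F a) /\ (exists2 b, b != k & F b <= - tau).
Proof.
move=> t0 tF Fj Fl.
have Fpos k : 0 < F k -> tau <= F k by move=> Fk; have := tF k; rewrite gtr0_norm.
have Fneg k : F k < 0 -> F k <= - tau.
  by move=> Fk; have := tF k; rewrite ltr0_norm // lerNr.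
have [m /andP[mj ml]] := third_index j l.
have F0 k : F k != 0 by rewrite -normr_gt0 (lt_le_trans t0).
have [Fm|Fm] := ltrP 0 (F m).
  exists l => k kl; split; last by exists l; rewrite 1?eq_sym ?Fneg.
  have [jk|jk] := eqVneq j k; last by exists j; rewrite ?Fpos.
  by exists m; rewrite -?jk ?Fpos.
exists j => k kj; split; first by exists j; rewrite 1?eq_sym ?Fpos.
have [lk|lk] := eqVneq l k; last by exists l; rewrite ?Fneg.
by exists m; rewrite -?lk ?Fneg // lt_neqAle F0.
Qed.

(** Origin of the threshold: with [B = 2 eps / (tau eta)], where [tau = delta / n] and
    [eta = gamma delta], all coordinates of [v] but one are at most [B], the last is at most
    [B / 2 + (n - 1) B], and their absolute values add up to at least 1. This fails once
    [2 n B < 1], that is, [eps < delta^2 gamma / (4 n^2)]. *)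
Lemma no_good_projection f v (eps : R) : dot v f = 1 -> dot f f = 1 -> 0 <= eps ->
  eps < delta ^+ 2 * gamma / (4 * n%:R ^+ 2) ->
  (forall phi, feasible phi -> forall i,
     `|dot phi (row i X - dot (row i X) f *: v)| <= 1 + eps) -> False.
Proof.
move=> vf f1 eps0 epsN proj.
have [d0 d1] := andP delta01; have [g0 g1] := andP gamma01.
have n0 : 0 < n%:R :> R by rewrite ltr0n (leq_trans _ n3).
pose tau := delta / n%:R.
have t0 : 0 < tau by rewrite divr_gt0.
have t1 : tau <= 1.
  by rewrite ler_pdivrMr // mul1r (le_trans d1) // ler1n (leq_trans _ n3).
have [u [u1 uf uZ]] : exists u, [/\ dot u u = 1, dot u f = 0 &
    forall j, j \in nearly_zero f -> dot u (row j X) ^+ 2 <= 1 / 2].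
  have [||u [u1 uf uZ]] :=
      @balanced_unit_vector _ _ f [seq row j X | j in nearly_zero f] n3.
  - by rewrite size_image card_nearly_zero.
  - by move=> z /imageP[j _ ->]; rewrite unitX.
  by exists u; split=> // j jZ; apply: uZ; apply: image_f.
(* The perturbation of [u] must be too small for [facet_vertex_near] to notice, and small against
   [tau], since it is all that moves [f] away from 0 at [y]. *)
pose kappa := tau / 100.
have kappa0 : 0 < kappa by rewrite /kappa; lra.
have [y yu ygen] := generic_near u kappa0.
have [i [phi [iI phii fphi]]] := facet_through nN basisX ygen.
have uA := basisX iI; set A := rowsub i X in phii uA.
set c := fun k => (y *m invmx A) ord0 k in phii.
have rowA k : row k A = row (i k) X by rewrite row_rowsub.
pose sg k := Num.sg (c k).
have sg2 k : sg k ^+ 2 = 1 by rewrite sqr_sg ygen.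
have sgn k : `|sg k| = 1 by rewrite normr_sg ygen.
(* The vertices of the facet are the points [sg k *: row (i k) X], where [phi] is 1; [F k] is the
   value of [f] there. *)
pose F k := sg k * dot (row (i k) X) f.
have dot_y z : dot z y = \sum_k `|c k| * (sg k * dot z (row (i k) X)).
  rewrite (dot_coord _ _ uA); apply: eq_bigr => k _.
  by rewrite rowA [in LHS](numEsg (_ ord0 k)) -/(c k) -/(sg k); ring.
(* [S] is the value of [phi] at [y]. It is nearly at least 1 because the functional [u] is at most 1
   at the points and nearly 1 at [y]. *)
pose S := \sum_k `|c k|.
have phiy : dot phi y = S.
  rewrite dot_y; apply: eq_bigr => k _.
  by rewrite phii -/(sg k) -expr2 sg2 mulr1.
have S1 : 1 - kappa <= S.
  have uyu : `|dot u (y - u)| <= kappa by apply: ler_dot; rewrite ?u1 ?mul1r // ltW.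
  have : dot u y <= S.
    rewrite dot_y; apply: ler_sum => k _; rewrite ler_piMr //.
    apply: le_trans (ler_norm _) _.
    by rewrite normrM sgn mul1r dot_unit_le1.
  have -> : dot u y = 1 + dot u (y - u) by rewrite dotBr u1; ring.
  by move: uyu; rewrite ler_norml => /andP[]; move: (dot u _) => a; lra.
(* The vertices are close to [u], and [u] was chosen away from the nearly zeros of [f]. *)
have Ftau k : tau <= `|F k|.
  rewrite normrM sgn mul1r leNgt; apply/negP => Fk.
  have ikZ : i k \in nearly_zero f by rewrite inE.
  have := uZ _ ikZ; apply/negP; rewrite -ltNge.
  have -> : dot u (row (i k) X) ^+ 2 = dot u (sg k *: row (i k) X) ^+ 2.
    by rewrite dotZr exprMn sg2 mul1r.
  have k1 : 0 <= kappa <= 1 / 100 by rewrite ltW //= /kappa; lra.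
  apply: (@facet_vertex_near u y phi _ kappa) => //.
  - by rewrite phiy.
  - by rewrite dotZl dotZr unitX mulr1 -expr2 sg2.
  - by rewrite dotZr phii -/(sg k) -expr2 sg2.
have fy : `|dot f y| <= kappa.
  have -> : dot f y = dot f (y - u) by rewrite dotBr (dotC f u) uf subr0.
  by apply: ler_dot; rewrite ?f1 ?mul1r // ltW.
have fyF : dot f y = \sum_k `|c k| * F k.
  by rewrite dot_y; apply: eq_bigr => k _; rewrite (dotC f).
have kS : kappa < tau * S.
  have : tau * (1 - kappa) <= tau * S by rewrite ler_pM2l.
  have : tau * kappa <= 1 * kappa by rewrite ler_pM2r.
  by rewrite /kappa; lra.
(* If all the [F k] had one sign, [|dot f y|] would be at least [tau * S], more than [kappa]. *)
have [j Fj] : exists j, 0 < F j.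
  apply/existsP; apply: contraLR fy => /existsPn h; rewrite -ltNge.
  apply: lt_le_trans kS _; rewrite -normrN.
  apply: le_trans (ler_norm _); rewrite fyF -sumrN mulr_sumr.
  apply: ler_sum => k _; rewrite mulrC -mulrN ler_wpM2l //.
  by have := Ftau k; rewrite ler0_norm // leNgt.
have [l Fl] : exists l, F l < 0.
  apply/existsP; apply: contraLR fy => /existsPn h; rewrite -ltNge.
  apply: lt_le_trans kS _; apply: le_trans (ler_norm _); rewrite fyF mulr_sumr.
  apply: ler_sum => k _; rewrite mulrC ler_wpM2l //.
  by have := Ftau k; rewrite ger0_norm // leNgt.
have [k0 hk0] := mixed_signs_but_one t0 Ftau Fj Fl.
(* For a vertex [y] with [psi y = 1], the bound [psi (y - f y *: v) <= 1 + eps]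
   reads [- f y * psi v <= eps]; vertices of both signs thus pin [psi v]. *)
have slack psi a b : feasible psi -> sg a * dot psi (row (i a) X) = 1 ->
    sg b * dot psi (row (i b) X) = 1 -> tau <= F a -> F b <= - tau ->
    `|dot psi v| <= eps / tau.
  move=> fpsi psia psib Fa Fb.
  have ineq k : sg k * dot psi (row (i k) X) = 1 -> - (F k * dot psi v) <= eps.
    move=> psik; have := proj _ fpsi (i k).
    rewrite -[leLHS]mul1r -[X in X * _](sgn k) -normrM dotBr dotZr mulrBr psik mulrA -/(F k).
    by move=> /(le_trans (ler_norm _)); rewrite lerD2l.
  rewrite ler_pdivlMr //; have := ineq a psia; have := ineq b psib.
  have [vp|vn] := lerP 0 (dot psi v).
    have : tau * dot psi v <= - F b * dot psi v by rewrite ler_wpM2r // lerNr.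
    rewrite ger0_norm //; move: (dot psi v) vp => a0; lra.
  have : tau * - dot psi v <= F a * - dot psi v by rewrite ler_wpM2r // oppr_ge0 ltW.
  rewrite ltr0_norm //; move: (dot psi v) vn => a0; lra.
(* The gap leaves room to tilt [phi] by [eta] so as to release one vertex [k]. *)
pose eta := gamma * delta.
have eta0 : 0 < eta by rewrite mulr_gt0.
have eta1 : eta <= 1 by rewrite mulr_ile1 // ltW.
have [e eE] : exists e : 'I_n -> 'rV[R]_n, forall k m,
    dot (e k) (row (i m) X) = sg k * (k == m)%:R.
  have /fin_all_exists[e eE] : forall k, exists e, forall m,
      dot e (row m A) = sg k * (k == m)%:R by move=> k; exact: dual_vector.
  by exists e => k m; rewrite -rowA.
have feas k : feasible (phi - eta *: e k).
  move=> m; rewrite dotBl dotZl.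
  have [/existsP[q /eqP <-]|] := boolP [exists q, i q == m].
    rewrite phii eE -/(sg q); have [<-|kq] := eqVneq k q; last first.
      by rewrite !mulr0 subr0 sgn.
    have -> : sg k - eta * (sg k * 1) = sg k * (1 - eta) by ring.
    by rewrite normrM sgn mul1r ger0_norm; lra.
  rewrite negb_exists => /forallP im.
  have gam : gamma <= 1 - `|dot phi (row m X)|.
    have phi1 k' : `|dot phi (row (i k') X)| = 1 by rewrite phii sgn.
    have := gapX iI phi1 (im : forall q, i q != m).
    by rewrite distrC [leRHS]ger0_norm // subr_ge0.
  apply: le_trans (ler_normB _ _) _.
  (* The coordinates of a unit vector are at most [1 / delta], so tilting by [eta = gamma * delta]
     changes values by at most the gap [gamma]. *)
  suff : `|eta * dot (e k) (row m X)| <= gamma.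
    by move: gam; move: `|dot phi _| `|eta * _| => a b; lra.
  rewrite (dot_coord _ _ uA) (bigD1 k) //= rowA eE eqxx mulr1 big1 => [|q qk].
    rewrite addr0 !normrM sgn mulr1 (gtr0_norm g0) (gtr0_norm d0) -mulrA -[leRHS]mulr1.
    by apply: ler_wpM2l; [exact: ltW | apply: coordX; rewrite ?unitX].
  by rewrite rowA eE eq_sym (negbTE qk) !mulr0.
pose V k := dot (e k) v.
(* For [k != k0] vertices of both signs remain when [k] is released, so [slack] applies to [phi] and
   to the tilted functional alike; their difference at [v] is [eta * V k]. *)
have Vle k : k != k0 -> `|V k| <= 2 * eps / (tau * eta).
  move=> /hk0[[a ak Fa] [b bk Fb]].
  have sphi q : sg q * dot phi (row (i q) X) = 1 by rewrite phii -expr2 sg2.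
  have spsi q : q != k -> sg q * dot (phi - eta *: e k) (row (i q) X) = 1.
    by move=> qk; rewrite dotBl dotZl eE eq_sym (negbTE qk) !mulr0 subr0.
  have h1 := slack phi a b fphi (sphi a) (sphi b) Fa Fb.
  have h2 := slack _ a b (feas k) (spsi a ak) (spsi b bk) Fa Fb.
  rewrite invfM mulrA ler_pdivlMr //.
  have -> : `|V k| * eta = `|dot phi v - dot (phi - eta *: e k) v|.
    by rewrite dotBl dotZl opprB addrC subrK normrM gtr0_norm // mulrC.
  apply: le_trans (ler_normB _ _) _; rewrite -mulrA mulr_natl mulr2n.
  exact: lerD.
have vE z : dot z v = \sum_k V k * (sg k * dot z (row (i k) X)).
  rewrite (dot_coord _ _ uA); apply: eq_bigr => k _; rewrite rowA /V.
  rewrite (dot_coord v (e k) uA) (bigD1 k) //= rowA eE eqxx big1 => [|q qk].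
    by rewrite mulr1 addr0 -mulrA [sg k * (_ * _)]mulrA -expr2 sg2 mul1r.
  by rewrite rowA eE eq_sym (negbTE qk) !mulr0.
have phiv : `|dot phi v| <= eps / tau.
  have sphi q : sg q * dot phi (row (i q) X) = 1 by rewrite phii -expr2 sg2.
  apply: (slack phi j l fphi (sphi j) (sphi l)).
    by have := Ftau j; rewrite gtr0_norm.
  by have := Ftau l; rewrite ltr0_norm // lerNr.
pose B := 2 * eps / (tau * eta).
have sumV : \sum_(k | k != k0) `|V k| <= n%:R * B - B.
  have -> : n%:R * B - B = \sum_(k | k != k0) B.
    have -> : n%:R * B = \sum_(k < n) B by rewrite sumr_const card_ord mulr_natl.
    by rewrite (bigD1 k0) //= addrAC subrr add0r.
  exact: ler_sum.
have V0 : `|V k0| <= `|dot phi v| + \sum_(k | k != k0) `|V k|.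
  have -> : V k0 = dot phi v - \sum_(k | k != k0) V k.
    rewrite vE (bigD1 k0) //= phii -expr2 sg2 mulr1.
    rewrite (eq_bigr V) ?addrK // => k _.
    by rewrite phii -expr2 sg2 mulr1.
  apply: le_trans (ler_normB _ _) _; rewrite lerD2l.
  exact: ler_norm_sum.
(* The sum of the [V k * F k] is [dot v f = 1], and [|F k| <= 1]. *)
have : 1 <= \sum_k `|V k|.
  rewrite -vf dotC vE; apply: ler_sum => k _.
  apply: le_trans (ler_norm _) _.
  by rewrite !normrM sgn mul1r ler_piMr // dot_unit_le1.
rewrite (bigD1 k0) //=.
have te0 : 0 < tau * eta by rewrite mulr_gt0.
have phivB : `|dot phi v| <= B / 2.
  apply: le_trans phiv _.
  have -> : B / 2 = eps / tau * eta^-1 by rewrite /B; field; rewrite !gt_eqF.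
  by rewrite ler_peMr ?invf_ge1 // divr_ge0 // ltW.
have nB : 2 * n%:R * B < 1.
  rewrite /B mulrA ltr_pdivrMr // mul1r.
  have -> : tau * eta = 4 * n%:R * (delta ^+ 2 * gamma / (4 * n%:R ^+ 2)).
    by rewrite /tau /eta; field; rewrite gt_eqF.
  have -> : 2 * n%:R * (2 * eps) = 4 * n%:R * eps by ring.
  by rewrite ltr_pM2l // mulr_gt0.
have B0 : 0 <= B by rewrite divr_ge0 ?(ltW te0) // mulr_ge0.
by move: sumV V0 phivB nB B0; move: `|V k0| `|dot phi v| (\sum_(k | _) _) => a b s; lra.
Qed.
End Deterministic.

(** * Reduction of the genericity conditions to distances from hyperplanes *)

Section BadConfigurations.
Variables (R : rcfType) (n N : nat).
Implicit Types (X : 'M[R]_(N, n)) (i : 'I_n -> 'I_N) (k : 'I_n).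

(* False for [w = 0]: that the normal vectors in use do not vanish is the matter
   of [staircase_unit]. *)
Definition near_hyperplane (delta : R) (w : 'rV[R]_n) (s : R) (y : 'rV[R]_n) :=
  (dot w w != 0) && ((dot y w - s) ^+ 2 <= delta ^+ 2 * dot w w).

Lemma cofactor_row_eq (A B : 'M[R]_n) k :
  (forall m, m != k -> row m A = row m B) -> cofactor_row A k = cofactor_row B k.
Proof.
move=> AB; apply/rowP => j; rewrite !mxE /cofactor; congr (_ * \det _).
apply/matrixP => a b; rewrite !mxE.
have := AB (lift k a); rewrite eq_sym neq_lift => /(_ erefl)/rowP/(_ (lift j b)).
by rewrite !mxE.
Qed.

Lemma dot_row_cofactor (A : 'M[R]_n) k l :
  dot (row k A) (cofactor_row A l) = (k == l)%:R * \det A.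
Proof.
have /matrixP/(_ k l) := mul_mx_adj A; rewrite !mxE mulr_natl => <-.
by apply: eq_bigr => j _; rewrite !mxE.
Qed.

(* Divided by [\det A], the functional equal to [(-1) ^+ sg k] on the row [k]. *)
Definition gap_normal (A : 'M[R]_n) (sg : 'I_n -> bool) : 'rV[R]_n :=
  \sum_k (-1) ^+ sg k *: cofactor_row A k.

Lemma dot_gap_normal (A : 'M[R]_n) sg k :
  dot (row k A) (gap_normal A sg) = (-1) ^+ sg k * \det A.
Proof.
rewrite dotC dot_suml (bigD1 k) //= big1 => [|l lk].
  by rewrite addr0 dotZl dotC dot_row_cofactor eqxx mul1r.
by rewrite dotZl dotC dot_row_cofactor eq_sym (negbTE lk) mul0r mulr0.
Qed.

Definition staircase X i (k : nat) : 'M[R]_n :=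
  \matrix_(m < n) (if (m < k)%N then row (i m) X else delta_mx ord0 m).

(* Trading the basis vectors for points of the configuration one at a time, the
   determinant vanishes only if a point hits a hyperplane independent of it. *)
Lemma staircase_unit X i :
  (forall k, ~~ near_hyperplane 0 (cofactor_row (staircase X i k) k) 0 (row (i k) X)) ->
  rowsub i X \in unitmx.
Proof.
move=> nnull.
have -> : rowsub i X = staircase X i n.
  by apply/row_matrixP => m; rewrite row_rowsub rowK ltn_ord.
rewrite unitmxE unitfE.
suff h (k : nat) : (k <= n)%N -> \det (staircase X i k) != 0 by exact: h.
elim: k => [_|k IH kn].
  have -> : staircase X i 0 = 1%:M by apply/row_matrixP => m; rewrite rowK row1.
  by rewrite det1 oner_neq0.
have {IH} := IH (ltnW kn).
pose k' := Ordinal kn; rewrite -(dot_cofactor_row _ k') -(dot_cofactor_row _ k').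
have wE : cofactor_row (staircase X i k.+1) k' = cofactor_row (staircase X i k) k'.
  apply: cofactor_row_eq => m mk; rewrite !rowK ltnS leq_eqVlt.
  by rewrite -[_ == _ :> nat]/(m == k') (negbTE mk).
rewrite wE.
have := nnull k'; rewrite negb_and negbK.
rewrite [row k' (staircase X i k.+1)]rowK /= ltnSn.
set w := cofactor_row _ _; rewrite expr0n mul0r subr0 -ltNge.
case/orP => [|h _]; first by rewrite dot_eq0 => /eqP ->; rewrite dot0r eqxx.
by apply: contraTneq h => ->; rewrite expr0n ltxx.
Qed.

(** By Cramer's rule the coordinate is [dot y w / dot x w], where [x] is the basis point and [w] its
    cofactor row. As [x] is far from the hyperplane, the denominator exceeds [delta] times the
    length of [w], and Cauchy-Schwarz bounds the numerator by that length. *)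
Lemma coord_bound X i k (delta : R) y : 0 <= delta -> rowsub i X \in unitmx ->
  ~~ near_hyperplane delta (cofactor_row (rowsub i X) k) 0 (row (i k) X) ->
  dot y y <= 1 -> delta * `|(y *m invmx (rowsub i X)) ord0 k| <= 1.
Proof.
move=> d0 uA nbad y1; rewrite coordE //; set w := cofactor_row _ _ in nbad *.
have detE : \det (rowsub i X) = dot (row (i k) X) w.
  by rewrite -(dot_cofactor_row _ k) row_rowsub.
have det0 : 0 < `|\det (rowsub i X)| by rewrite normr_gt0 -unitfE -unitmxE.
rewrite normrM normfV mulrA ler_pdivrMr // mul1r.
move: nbad; rewrite negb_and negbK subr0 -ltNge -detE => /orP[|h].
  by rewrite dot_eq0 => /eqP ->; rewrite dot0r normr0 mulr0 ltW.
rewrite -ler_sqr ?nnegrE ?mulr_ge0 // exprMn !real_normK ?num_real //.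
apply: le_trans (ltW h); rewrite ler_wpM2l ?sqr_ge0 //.
by apply: le_trans (cauchy_schwarz _ _) _; rewrite ler_piMl // dot_ge0.
Qed.

(** Up to the sign of [phi], the gap normal is [\det A] times [phi], so the slab condition compares
    [|dot phi x - 1| * |\det A|] with [gamma] times the length of the normal. That length is at
    least [|\det A|], because [phi] has absolute value 1 at a unit vector. *)
Lemma gap_bound X i (gamma : R) phi j : (0 < n)%N -> 0 <= gamma ->
  (forall l, dot (row l X) (row l X) = 1) ->
  rowsub i X \in unitmx ->
  (forall sg : {ffun 'I_n -> bool}, ~~ near_hyperplane gamma
     (gap_normal (rowsub i X) sg) (\det (rowsub i X)) (row j X)) ->
  (forall k, `|dot phi (row (i k) X)| = 1) ->
  gamma <= `| `|dot phi (row j X)| - 1|.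
Proof.
move=> n0 g0 unitX uA; wlog pos : phi / 0 <= dot phi (row j X) => [hw|] nbad phi1.
  have [|neg] := lerP 0 (dot phi (row j X)); first by move=> /hw; apply.
  have := hw (- phi); rewrite !dotNl oppr_ge0 normrN; apply => //; first exact: ltW.
  by move=> k; rewrite dotNl normrN.
pose sg : {ffun 'I_n -> bool} := [ffun k => dot phi (row (i k) X) < 0].
set A := rowsub i X in uA nbad.
have det0 : \det A != 0 by rewrite -unitfE -unitmxE.
have phik k : dot phi (row k A) = (-1) ^+ sg k.
  rewrite row_rowsub ffunE; have := phi1 k; have [p0|p0] := ltrP (dot phi _) 0.
    by rewrite ltr0_norm // expr1 => /(congr1 -%R); rewrite opprK.
  by rewrite ger0_norm.
have phiE z : dot z (gap_normal A sg) = dot phi z * \det A.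
  rewrite dotC (dot_coord z (gap_normal A sg) uA) (dot_coord z phi uA) mulr_suml.
  by apply: eq_bigr => k _; rewrite dotC dot_gap_normal phik mulrA.
have normal_det : (\det A) ^+ 2 <= dot (gap_normal A sg) (gap_normal A sg).
  have := cauchy_schwarz (row (i (Ordinal n0)) X) (gap_normal A sg).
  rewrite unitX mul1r phiE -(row_rowsub i X (Ordinal n0)) phik exprMn -exprM mulnC exprM.
  by rewrite sqrrN !expr1n mul1r.
have := nbad sg; rewrite negb_and negbK -ltNge (phiE (row j X)) => /orP[/eqP w0|h].
  by move: normal_det; rewrite w0 leNgt lt_neqAle sqr_ge0 eq_sym sqrf_eq0 det0.
rewrite (ger0_norm pos) -ler_sqr ?nnegrE // real_normK ?num_real //.
have det2 : 0 < (\det A) ^+ 2 by rewrite lt_neqAle sqr_ge0 eq_sym sqrf_eq0 det0.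
rewrite -(ler_pM2r det2) -[leRHS]exprMn mulrBl mul1r.
by apply: le_trans (ltW h); rewrite ler_wpM2l // sqr_ge0.
Qed.

End BadConfigurations.

(** * Householder reflections *)

Section Householder.
Variables (R : realFieldType) (n : nat).

Definition householder (w : 'rV[R]_n) : 'M[R]_n := 1%:M - (2 / dot w w) *: (w^T *m w).

Lemma mulmx_tr_dot (u v : 'rV[R]_n) : u *m v^T = (dot u v)%:M.
Proof.
apply/matrixP => i j; rewrite !ord1 !mxE eqxx mulr1n.
by apply: eq_bigr => k _; rewrite !mxE.
Qed.

Lemma mul_householder (w x : 'rV[R]_n) :
  x *m householder w = x - (2 / dot w w * dot x w) *: w.
Proof.
rewrite mulmxBr mulmx1 -scalemxAr mulmxA mulmx_tr_dot mul_scalar_mx.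
by rewrite scalerA.
Qed.

Lemma dot_householder (w x z : 'rV[R]_n) :
  dot (x *m householder w) z = dot x z - 2 / dot w w * dot x w * dot w z.
Proof. by rewrite mul_householder dotBl dotZl. Qed.

Lemma householder_orthogonal (w : 'rV[R]_n) :
  householder w *m (householder w)^T = 1%:M.
Proof.
have -> : (householder w)^T = householder w.
  by rewrite linearB /= trmx1 linearZ /= trmx_mul trmxK.
apply/row_matrixP => i; rewrite row_mul [row i (householder w)]rowE row1.
move: (delta_mx _ _) => x; rewrite !mul_householder dotBl dotZl.
have [->|w0] := eqVneq w 0; first by rewrite !(scaler0, subr0).
have -> : 2 / dot w w * (dot x w - 2 / dot w w * dot x w * dot w w) =
    - (2 / dot w w * dot x w) by field; rewrite dot_eq0.
by rewrite scaleNr opprK subrK.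
Qed.

End Householder.

(** * Three points of a circle in a slab *)

Section ThreePoints.
Variable R : realFieldType.

(* Three points of the unit circle, pairwise [d] apart, do not fit in a thin
   slab: up to sign, twice the area of the triangle is half the product of the
   side lengths. *)
Lemma three_points_in_slab (a1 b1 a2 b2 a3 b3 p q t delta d rho2 : R) :
  a1 ^+ 2 + b1 ^+ 2 = 1 -> a2 ^+ 2 + b2 ^+ 2 = 1 -> a3 ^+ 2 + b3 ^+ 2 = 1 ->
  0 < d -> d <= `|a1 - a2| -> d <= `|a2 - a3| -> d <= `|a1 - a3| ->
  `|p * a1 + q * b1 - t| <= delta -> `|p * a2 + q * b2 - t| <= delta ->
  `|p * a3 + q * b3 - t| <= delta -> 0 <= rho2 <= p ^+ 2 + q ^+ 2 ->
  rho2 * d ^+ 4 <= 64 * delta ^+ 2.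
Proof.
move=> u1 u2 u3 d0 d12 d23 d13 h1 h2 h3 /andP[r0 rq].
have sqd x y : d <= `|x - y| -> d ^+ 2 <= (x - y) ^+ 2.
  by move=> h; rewrite -(real_normK (num_real (x - y))) ler_sqr ?nnegrE // ltW.
have slab x y z w : `|p * x + q * y - t| <= delta -> `|p * z + q * w - t| <= delta ->
    (p * (z - x) + q * (w - y)) ^+ 2 <= 4 * delta ^+ 2.
  move=> g1 g2; have -> : 4 * delta ^+ 2 = (2 * delta) ^+ 2 by ring.
  rewrite -(real_normK (num_real (p * _ + _))) ler_sqr ?nnegrE //; last first.
    by have := le_trans (normr_ge0 _) g1; lra.
  have -> : p * (z - x) + q * (w - y) = (p * z + q * w - t) - (p * x + q * y - t) by ring.
  by apply: le_trans (ler_normB _ _) _; lra.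
pose AA := (a2 - a1) ^+ 2 + (b2 - b1) ^+ 2.
pose BB := (a3 - a1) ^+ 2 + (b3 - b1) ^+ 2.
pose CC := (a3 - a2) ^+ 2 + (b3 - b2) ^+ 2.
pose D := (a2 - a1) * (b3 - b1) - (b2 - b1) * (a3 - a1).
pose yA := p * (a2 - a1) + q * (b2 - b1).
pose yB := p * (a3 - a1) + q * (b3 - b1).
(* The area of a triangle inscribed in the unit circle is a quarter of the product of its sides, and
   [D] is twice the signed area. In terms of inner products this is the vanishing of the Gram
   determinant of three plane vectors. *)
have area : 4 * D ^+ 2 = AA * BB * CC.
  pose x := a1 * a2 + b1 * b2; pose y := a1 * a3 + b1 * b3; pose z := a2 * a3 + b2 * b3.
  have gram : 1 + 2 * x * y * z - x ^+ 2 - y ^+ 2 - z ^+ 2 = 0.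
    transitivity ((a1 ^+ 2 + b1 ^+ 2) * (a2 ^+ 2 + b2 ^+ 2) * (a3 ^+ 2 + b3 ^+ 2)
      + 2 * x * y * z - x ^+ 2 * (a3 ^+ 2 + b3 ^+ 2) - y ^+ 2 * (a2 ^+ 2 + b2 ^+ 2)
      - z ^+ 2 * (a1 ^+ 2 + b1 ^+ 2)); first by rewrite u1 u2 u3; ring.
    by rewrite /x /y /z; ring.
  have AE : AA = 2 - 2 * x.
    by transitivity ((a1 ^+ 2 + b1 ^+ 2) + (a2 ^+ 2 + b2 ^+ 2) - 2 * x);
      [rewrite /AA /x; ring | rewrite u1 u2; ring].
  have BE : BB = 2 - 2 * y.
    by transitivity ((a1 ^+ 2 + b1 ^+ 2) + (a3 ^+ 2 + b3 ^+ 2) - 2 * y);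
      [rewrite /BB /y; ring | rewrite u1 u3; ring].
  have CE : CC = 2 - 2 * z.
    by transitivity ((a2 ^+ 2 + b2 ^+ 2) + (a3 ^+ 2 + b3 ^+ 2) - 2 * z);
      [rewrite /CC /z; ring | rewrite u2 u3; ring].
  have -> : D ^+ 2 = AA * BB - (z - x - y + 1) ^+ 2.
    transitivity (AA * BB - (z - x - y + (a1 ^+ 2 + b1 ^+ 2)) ^+ 2); last by rewrite u1.
    by rewrite /D /AA /BB /x /y /z; ring.
  apply/eqP; rewrite -subr_eq0; apply/eqP.
  transitivity (4 * (1 + 2 * x * y * z - x ^+ 2 - y ^+ 2 - z ^+ 2)).
    by rewrite AE BE CE; ring.
  by rewrite gram mulr0.
have hA : yA ^+ 2 <= 4 * delta ^+ 2 by exact: slab.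
have hB : yB ^+ 2 <= 4 * delta ^+ 2 by exact: slab.
have AA0 : d ^+ 2 <= AA by have := sqd _ _ d12; have := sqr_ge0 (b2 - b1); rewrite /AA; lra.
have BB0 : d ^+ 2 <= BB by have := sqd _ _ d13; have := sqr_ge0 (b3 - b1); rewrite /BB; lra.
have CC0 : d ^+ 2 <= CC by have := sqd _ _ d23; have := sqr_ge0 (b3 - b2); rewrite /CC; lra.
have d2 : 0 < d ^+ 2 by rewrite exprn_gt0.
(* Cramer's rule gives [p * D] and [q * D] as differences of multiples of [yA] and [yB]; the sum of
   their squares is bounded by the parallelogram law. *)
have upper : (p ^+ 2 + q ^+ 2) * D ^+ 2 <= 8 * delta ^+ 2 * (AA + BB).
  have -> : (p ^+ 2 + q ^+ 2) * D ^+ 2 = 2 * (yA ^+ 2 * BB + yB ^+ 2 * AA) -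
      ((yA * (b3 - b1) + yB * (b2 - b1)) ^+ 2 + (yB * (a2 - a1) + yA * (a3 - a1)) ^+ 2).
    by rewrite /yA /yB /AA /BB /D; ring.
  have h4 : yA ^+ 2 * BB <= 4 * delta ^+ 2 * BB by rewrite ler_wpM2r //; lra.
  have h5 : yB ^+ 2 * AA <= 4 * delta ^+ 2 * AA by rewrite ler_wpM2r //; lra.
  have := sqr_ge0 (yA * (b3 - b1) + yB * (b2 - b1)).
  have := sqr_ge0 (yB * (a2 - a1) + yA * (a3 - a1)).
  move: h4 h5; move: (_ ^+ 2 * BB) (_ ^+ 2 * AA) ((_ + _) ^+ 2) ((_ + _) ^+ 2).
  by move=> e1 e2 e3 e4; lra.
(* The third side enters only through [d], which leaves a comparison of [AA * BB] with [AA + BB]. *)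
have lower : rho2 * (AA * BB * d ^+ 2) <= 32 * delta ^+ 2 * (AA + BB).
  have h6 : AA * BB * d ^+ 2 <= 4 * D ^+ 2.
    by rewrite area ler_wpM2l // mulr_ge0 //; lra.
  have h7 : rho2 * (AA * BB * d ^+ 2) <= rho2 * (4 * D ^+ 2) by rewrite ler_wpM2l.
  have h8 : rho2 * (4 * D ^+ 2) <= (p ^+ 2 + q ^+ 2) * (4 * D ^+ 2).
    by rewrite ler_wpM2r // mulr_ge0 // sqr_ge0.
  by move: upper h7 h8; move: (rho2 * _) (rho2 * _) => e1 e2; lra.
have prodAB : (AA + BB) * d ^+ 2 <= 2 * (AA * BB).
  have h9 : AA * d ^+ 2 <= AA * BB by rewrite ler_wpM2l //; lra.
  have h10 : BB * d ^+ 2 <= BB * AA by rewrite ler_wpM2l //; lra.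
  by lra.
have AB0 : 0 < AA + BB by lra.
suff : rho2 * d ^+ 4 * (AA + BB) <= 64 * delta ^+ 2 * (AA + BB) by rewrite ler_pM2r.
have -> : rho2 * d ^+ 4 * (AA + BB) = rho2 * d ^+ 2 * ((AA + BB) * d ^+ 2) by ring.
have h11 : rho2 * d ^+ 2 * ((AA + BB) * d ^+ 2) <= rho2 * d ^+ 2 * (2 * (AA * BB)).
  by rewrite ler_wpM2l // mulr_ge0 // ltW.
move: lower h11; lra.
Qed.
End ThreePoints.

From mathcomp Require Import all_classical all_reals all_analysis.
From mathcomp Require Import measurable_realfun.

Import numFieldNormedType.Exports.

Local Open Scope classical_set_scope.
Local Open Scope ring_scope.

(** * Numerical estimates *)

Section Numerics.
Variable R : realType.

(** The case [t = 27] follows from [14 <= expR 3] and [27 ^ 7 <= 14 ^ 9]. For [t = 27 * y] with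
    [1 <= y], the 27th power of [expR 1 * y <= expR y] leaves [y ^ 27] to beat [y ^ 7]. *)
Lemma expr7_le_expR (t : R) : 27 <= t -> t ^+ 7 <= expR t.
Proof.
move=> t27.
have e3 : 14 <= expR 3 :> R.
  have -> : expR 3 = expR (1 / 4) ^+ 12 :> R by rewrite -expRM_natl; congr expR; lra.
  have h : 5 / 4 <= expR (1 / 4) :> R.
    by apply: le_trans (expR_ge1Dx _); lra.
  apply: (@le_trans _ _ ((5 / 4) ^+ 12)); first by lra.
  by apply: lerXn2r h; rewrite nnegrE ?expR_ge0 //; lra.
have e27 : 27 ^+ 7 <= expR 27 :> R.
  have -> : expR 27 = expR 3 ^+ 9 :> R by rewrite -expRM_natl; congr expR; lra.
  apply: (@le_trans _ _ (14 ^+ 9)); first by lra.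
  by apply: lerXn2r e3; rewrite nnegrE ?expR_ge0.
pose y := t / 27.
have y1 : 1 <= y by rewrite ler_pdivlMr //; lra.
have tE : t = 27 * y by rewrite /y; lra.
have hy : expR 1 * y <= expR y.
  have -> : expR y = expR 1 * expR (y - 1) by rewrite -expRD; congr expR; lra.
  by rewrite ler_pM2l ?expR_gt0 //; apply: le_trans (expR_ge1Dx _); lra.
have -> : expR t = expR y ^+ 27 by rewrite tE -expRM_natl.
apply: (@le_trans _ _ ((expR 1 * y) ^+ 27)); last first.
  by apply: lerXn2r hy; rewrite nnegrE ?mulr_ge0 ?expR_ge0 //; lra.
rewrite tE; move: y y1 {hy tE} => y y1; rewrite !exprMn.
have -> : expR 1 ^+ 27 = expR 27 :> R by rewrite -expRM_natl; congr expR; lra.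
by apply: ler_pM; [apply: exprn_ge0; lra | apply: exprn_ge0; lra | exact: e27 |
  exact: ler_weXn2l].
Qed.

(** With [t = N / K >= a], the left side is at most [K * expR (- t)], so [K * N <= expR t] suffices;
    and [K * N = a ^ 6 * t <= t ^ 7]. *)
Lemma net_failure_bound (K N a : nat) : (27 <= a)%N -> K = (a ^ 3)%N -> (a ^ 4 <= N)%N ->
  K%:R * (1 - K%:R^-1) ^+ N <= N%:R^-1 :> R.
Proof.
move=> a27 KE aN.
have a0 : 0 < a%:R :> R by rewrite ltr0n (leq_trans _ a27).
have K0 : 0 < K%:R :> R by rewrite KE natrX exprn_gt0.
have N0 : 0 < N%:R :> R by rewrite ltr0n (leq_trans _ aN) // expn_gt0 (leq_trans _ a27).
pose t : R := N%:R / K%:R.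
have at_ : a%:R <= t.
  rewrite ler_pdivlMr // KE -natrM ler_nat; apply: leq_trans aN.
  by rewrite -expnS.
have t27 : 27 <= t by apply: le_trans at_; rewrite ler_nat.
have h1 : (1 - K%:R^-1) ^+ N <= expR (- t) :> R.
  have -> : expR (- t) = expR (- K%:R^-1) ^+ N.
    by rewrite -expRM_natl; congr expR; rewrite mulrN.
  apply: lerXn2r; rewrite ?nnegrE ?expR_ge0 ?expR_ge1Dx //.
  by rewrite subr_ge0 invf_le1 // KE natrX exprn_ege1 // ler1n (leq_trans _ a27).
have NE : N%:R = t * K%:R by rewrite /t divfK // gt_eqF.
apply: (@le_trans _ _ (K%:R * expR (- t))); first by rewrite ler_pM2l.
rewrite -[leRHS]mul1r ler_pdivlMr // expRN mulrAC ler_pdivrMr ?expR_gt0 // mul1r.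
apply: le_trans (expr7_le_expR t27).
have t0 : 0 <= t by apply: le_trans t27.
have KE' : K%:R = a%:R ^+ 3 :> R by rewrite KE natrX.
have -> : K%:R * N%:R = a%:R ^+ 6 * t by rewrite NE KE'; ring.
rewrite [leRHS]exprSr ler_wpM2r //.
by apply: lerXn2r; rewrite ?nnegrE // ltW.
Qed.

(** The surplus exponent of [N] is [b = 2 n^2 - 2 n - 2], and [N ^ b >= n ^ (4 n b)] exceeds all
    powers of [n] on the left; the [+ 2] in [e2] pays for the factor 4, by [4 < n ^ 2]. *)
Lemma exponent_bound n N : (3 <= n)%N -> (n ^ (4 * n) <= N)%N ->
  (n ^ (2 * n ^ 2 + 7 * n - 11) * (4 * n ^ (2 * n + 27) * N ^ (6 * n + 8)) <
   N ^ (2 * n ^ 2 + 4 * n + 6))%N.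
Proof.
move=> n3 nN; have n0 : (0 < n)%N by exact: leq_trans n3.
have N0 : (0 < N)%N by apply: leq_trans nN; rewrite expn_gt0 n0.
have e1 : (2 * n ^ 2 + 4 * n + 6 = (2 * n ^ 2 - 2 * n - 2) + (6 * n + 8))%N by nia.
have e2 : (2 * n ^ 2 + 7 * n - 11 + (2 * n + 27) + 2 <= 4 * n * (2 * n ^ 2 - 2 * n - 2))%N.
  by nia.
have e3 : (0 < 2 * n ^ 2 - 2 * n - 2)%N by nia.
have n4 : (4 < n ^ 2)%N by nia.
rewrite e1 [ltnRHS]expnD; move: (2 * n ^ 2 - 2 * n - 2)%N e2 e3 => b.
move: (2 * n ^ 2 + 7 * n - 11)%N (2 * n + 27)%N (6 * n + 8)%N => a c d e2 b0.
rewrite mulnA ltn_pmul2r ?expn_gt0 ?N0 //.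
apply: leq_trans (_ : (n ^ (4 * n)) ^ b <= _)%N; last by rewrite leq_exp2r.
rewrite -expnM; apply: leq_trans (leq_pexp2l n0 e2).
by rewrite mulnCA -expnD [ltnRHS]expnD mulnC ltn_pmul2l // expn_gt0 n0.
Qed.

End Numerics.

(** * The norm of a configuration and measurability of the event *)

Section L1Norm.
Variables (R : realType).

Definition l1 n (a : 'rV[R]_n) : R := \sum_j `|a ord0 j|.

Lemma l1_ge0 n (a : 'rV[R]_n) : 0 <= l1 a.
Proof. exact: sumr_ge0. Qed.

Lemma l1_eq0 n (a : 'rV[R]_n) : l1 a = 0 -> a = 0.
Proof.
move=> a0; apply/rowP => j; rewrite mxE; apply/normr0_eq0.
by move: j (erefl true); apply: psumr_eq0P a0.
Qed.

Lemma l1Z n c (a : 'rV[R]_n) : l1 (c *: a) = `|c| * l1 a.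
Proof. by rewrite mulr_sumr; apply: eq_bigr => j _; rewrite mxE normrM. Qed.

Lemma l1D n (a b : 'rV[R]_n) : l1 (a + b) <= l1 a + l1 b.
Proof. by rewrite -big_split ler_sum // => j _; rewrite mxE ler_normD. Qed.

Lemma l1_mulmx n m (a : 'rV[R]_m) (A : 'M[R]_(m, n)) r :
  (forall i, l1 (row i A) <= r) -> l1 (a *m A) <= l1 a * r.
Proof.
move=> Ar; rewrite mulmx_sum_row mulr_suml.
elim/big_ind2 : _ => [|x1 x2 y1 y2 h1 h2|i _].
- by rewrite /l1 big1 // => j _; rewrite mxE normr0.
- by apply: le_trans (l1D _ _) _; exact: lerD.
- by rewrite l1Z ler_wpM2l.
Qed.

Lemma l1_delta n (i : 'I_n) (s : R) : l1 (s *: delta_mx ord0 i) = `|s|.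
Proof.
rewrite l1Z /l1 (bigD1 i) //= mxE !eqxx normr1 big1 ?addr0 ?mulr1 // => j ji.
by rewrite mxE (negbTE ji) andbF normr0.
Qed.

Lemma convex_set_line (V : lmodType R) (C : set V) x y (t : R) :
  convex_set C -> C x -> C y -> 0 <= t <= 1 -> C (t *: x + (1 - t) *: y).
Proof.
move=> cC Cx Cy t01.
have /set_mem := cC x y (Itv01 (andP t01).1 (andP t01).2) (mem_set Cx) (mem_set Cy).
by [].
Qed.

(** Since [C] contains 0, a combination of total weight at most [t] lies in [t *: C]. Carrying the
    scale [t] spares the induction a renormalization of the remaining weights. *)
Lemma convex_set_cone (V : lmodType R) (C : set V) n (w : 'I_n -> R) (z : 'I_n -> V) t :
  convex_set C -> C 0 -> (forall i, C (z i)) -> (forall i, 0 <= w i) ->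
  \sum_i w i <= t -> exists2 c, C c & \sum_i w i *: z i = t *: c.
Proof.
move=> cC C0 Cz w0; elim: n w z Cz w0 t => [|n IH] w z Cz w0 t.
  by rewrite !big_ord0 => _; exists 0; rewrite ?scaler0.
rewrite !big_ord_recl -lerBrDl => wt.
have [c Cc ->] := IH _ _ (fun i => Cz (lift ord0 i)) (fun i => w0 (lift ord0 i)) _ wt.
have w0t : 0 <= t - w ord0 by apply: le_trans wt; exact: sumr_ge0.
have t0 : 0 <= t by rewrite (le_trans (w0 ord0)) // -subr_ge0.
have [tE|tN] := eqVneq t 0.
  have wE : w ord0 = 0.
    by apply/eqP; rewrite eq_le w0 andbT -oppr_ge0; rewrite tE sub0r in w0t.
  by exists 0 => //; rewrite tE wE subrr !scale0r addr0.
exists ((w ord0 / t) *: z ord0 + (1 - w ord0 / t) *: c).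
  have t_gt0 : 0 < t by rewrite lt_neqAle eq_sym tN.
  apply: (convex_set_line cC (Cz ord0) Cc).
  by rewrite divr_ge0 //= ler_pdivrMr // mul1r -subr_ge0.
by rewrite scalerDr !scalerA mulrBr mulr1 [t * _]mulrC divfK.
Qed.

End L1Norm.

(** * Continuity of polynomial expressions in the entries of a matrix *)

Section ContinuousBig.
Variables (R : realType) (T : topologicalType) (I : Type) (r : seq I).
Variables (F : I -> T -> R) (x : T).
Hypothesis cF : forall i, {for x, continuous (F i)}.

Lemma continuous_sum : {for x, continuous (fun y => \sum_(i <- r) F i y)}.
Proof.
elim: r => [|i s IH].
  by rewrite /prop_for /continuous_at big_nil; under eq_cvg do rewrite big_nil; exact: cvg_cst.
rewrite /prop_for /continuous_at big_cons; under eq_cvg do rewrite big_cons.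
by apply: cvgD; [exact: cF | exact: IH].
Qed.

Lemma continuous_prod : {for x, continuous (fun y => \prod_(i <- r) F i y)}.
Proof.
elim: r => [|i s IH].
  by rewrite /prop_for /continuous_at big_nil; under eq_cvg do rewrite big_nil; exact: cvg_cst.
rewrite /prop_for /continuous_at big_cons; under eq_cvg do rewrite big_cons.
by apply: cvgM; [exact: cF | exact: IH].
Qed.

End ContinuousBig.

Section ContinuousMatrix.
Variables (R : realType) (T : topologicalType) (x : T).

Definition entries_continuous m n (G : T -> 'M[R]_(m, n)) :=
  forall i j, {for x, continuous (fun y => G y i j)}.

Lemma entries_continuous_cst m n (A : 'M[R]_(m, n)) : entries_continuous (fun=> A).
Proof. by move=> i j; exact: cvg_cst. Qed.

Lemma entries_continuousB m n (G H : T -> 'M[R]_(m, n)) : entries_continuous G ->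
  entries_continuous H -> entries_continuous (fun y => G y - H y).
Proof.
move=> cG cH i j; have -> : (fun y => (G y - H y) i j) = (fun y => G y i j - H y i j).
  by apply/funext => y; rewrite !mxE.
exact: continuousB (cG i j) (cH i j).
Qed.

Lemma entries_continuousD m n (G H : T -> 'M[R]_(m, n)) : entries_continuous G ->
  entries_continuous H -> entries_continuous (fun y => G y + H y).
Proof.
move=> cG cH i j; have -> : (fun y => (G y + H y) i j) = (fun y => G y i j + H y i j).
  by apply/funext => y; rewrite !mxE.
exact: continuousD (cG i j) (cH i j).
Qed.

Lemma entries_continuousM m n p (G : T -> 'M[R]_(m, n)) (H : T -> 'M[R]_(n, p)) :
  entries_continuous G -> entries_continuous H -> entries_continuous (fun y => G y *m H y).
Proof.
move=> cG cH i j.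
have -> : (fun y => (G y *m H y) i j) = (fun y => \sum_k G y i k * H y k j).
  by apply/funext => y; rewrite !mxE.
by apply: continuous_sum => k; exact: continuousM (cG i k) (cH k j).
Qed.

Lemma entries_continuousZ m n (f : T -> R) (G : T -> 'M[R]_(m, n)) :
  {for x, continuous f} -> entries_continuous G ->
  entries_continuous (fun y => f y *: G y).
Proof.
move=> cf cG i j; have -> : (fun y => (f y *: G y) i j) = (fun y => f y * G y i j).
  by apply/funext => y; rewrite !mxE.
exact: continuousM cf (cG i j).
Qed.

Lemma continuous_det n (G : T -> 'M[R]_n) : entries_continuous G ->
  {for x, continuous (fun y => \det (G y))}.
Proof.
move=> cG; apply: continuous_sum => s; apply: (@continuousM _ _ (fun=> _)).
  exact: cvg_cst.
by apply: continuous_prod => i; exact: cG.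
Qed.

Lemma entries_continuous_adj n (G : T -> 'M[R]_n) : entries_continuous G ->
  entries_continuous (fun y => \adj (G y)).
Proof.
move=> cG i j.
have -> : (fun y => (\adj (G y)) i j) = (fun y => cofactor (G y) j i).
  by apply/funext => y; rewrite !mxE.
apply: (@continuousM _ _ (fun=> _)); first exact: cvg_cst.
apply: continuous_det => k l.
have -> : (fun y => row' j (col' i (G y)) k l) = (fun y => G y (lift j k) (lift i l)).
  by apply/funext => y; rewrite !mxE.
exact: cG.
Qed.

End ContinuousMatrix.

Section Hull.
Variables (R : realType) (n N : nat).
Implicit Types X : 'M[R]_(N, n).

(** The image of the l1 ball is convex and contains the signed points; conversely the signs of the
    coefficients move to the points, leaving nonnegative weights of total at most 1. The total may
    be less than 1 because the hull contains 0, which takes at least one point. *)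
Lemma symmetric_hullE X : (0 < N)%N ->
  symmetric_hull (fun i => row i X) =
  [set y | exists2 a : 'rV[R]_N, l1 a <= 1 & y = a *m X].
Proof.
move=> N0; apply/seteqP; split.
  apply: smallest_sub => [x y t|_ [i [->|->]]].
  - rewrite !inE => -[a a1 ->] [b b1 ->].
    exists (t%:num *: a + (1 - t%:num) *: b); last by rewrite mulmxDl -!scalemxAl.
    apply: le_trans (l1D _ _) _; rewrite !l1Z !ger0_norm ?subr_ge0 //.
    have t1 : t%:num <= 1 by [].
    have t0 : 0 <= t%:num by [].
    have h1 : t%:num * l1 a <= t%:num * 1 by apply: ler_wpM2l.
    have h2 : (1 - t%:num) * l1 b <= (1 - t%:num) * 1.
      by apply: ler_wpM2l => //; rewrite subr_ge0.
    by apply: le_trans (lerD h1 h2) _; rewrite !mulr1 addrC subrK.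
  - exists (1 *: delta_mx ord0 i); first by rewrite l1_delta normr1.
    by rewrite scale1r -rowE.
  - exists (-1 *: delta_mx ord0 i); first by rewrite l1_delta normrN normr1.
    by rewrite -scalemxAl -rowE scaleN1r.
move=> _ [a a1 ->] C [cC CX].
have Cx i : C (row i X) by apply: CX; exists i; left.
have CNx i : C (- row i X) by apply: CX; exists i; right.
have C0 : C 0.
  have i : 'I_N := Ordinal N0.
  have := convex_set_line cC (Cx i) (CNx i) (_ : 0 <= 1 / 2 <= 1).
  have -> : 1 / 2 *: row i X + (1 - 1 / 2) *: - row i X = 0.
    rewrite scalerN -scalerBl (_ : 1 / 2 - _ = 0) ?scale0r //; lra.
  by apply; lra.
pose z i := Num.sg (a ord0 i) *: row i X.
have Cz i : C (z i).
  rewrite /z; case: sgrP => _; first by rewrite scale0r.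
  - by rewrite scale1r.
  - by rewrite scaleN1r.
have [c Cc] := convex_set_cone cC C0 Cz (fun i => normr_ge0 (a ord0 i)) a1.
rewrite scale1r mulmx_sum_row => cE.
suff -> : \sum_i a ord0 i *: row i X = c by [].
rewrite -cE; apply: eq_bigr => i _.
by rewrite /z scalerA mulrC -numEsg.
Qed.

(* The norm with unit ball the symmetric hull is the quotient of the l1 norm by
   the map [a |-> a *m X], which is onto because of the left inverse [L]. *)
Definition hull_norm X (y : 'rV[R]_n) : R := inf [set l1 a | a in [set a | a *m X = y]].

Lemma hull_norm_le X (a : 'rV[R]_N) : hull_norm X (a *m X) <= l1 a.
Proof.
apply: ge_inf; last by exists a.
by exists 0 => _ [b _ <-]; exact: l1_ge0.
Qed.

Lemma continuous_l1 m : continuous (@l1 R m).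
Proof.
move=> a; apply: (@continuous_sum _ _ _ _ (fun j (a : 'rV[R]_m) => `|a ord0 j|)) => j.
by apply: (@continuous_comp _ _ _ (fun a : 'rV[R]_m => a ord0 j));
  [exact: coord_continuous | exact: norm_continuous].
Qed.

Lemma norm_le_l1 m (a : 'rV[R]_m) : `|a| <= l1 a.
Proof.
rewrite [leLHS]mx_normrE; apply/bigmax_leP; split=> [|[i j] _ /=]; first exact: l1_ge0.
by rewrite ord1 /l1 (bigD1 j) //= lerDl sumr_ge0.
Qed.

(** The coefficient vectors of [y] no longer than the particular one [y *m L] form a compact set.
    Attainment gives definiteness of the norm and makes its unit ball exactly the hull. *)
Lemma hull_norm_attained X (L : 'M[R]_(n, N)) y : L *m X = 1%:M ->
  exists2 a, a *m X = y & l1 a = hull_norm X y.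
Proof.
move=> LX.
pose M := l1 (y *m L).
pose K := [set a : 'rV[R]_N | a *m X = y] `&` [set a | l1 a <= M].
have yK : K (y *m L) by split=> /=; rewrite -?mulmxA ?LX ?mulmx1 ?lexx.
have clK : closed K.
  apply: closedI; last first.
    apply: (preimage_closed _ (@closed_le _ M)) => a _.
    exact: continuous_l1.
  have -> : [set a : 'rV[R]_N | a *m X = y] =
      \bigcap_(j : 'I_n) [set a | (a *m X) ord0 j = y ord0 j].
    apply/seteqP; split => [a /= aX j _|a h]; first by rewrite /= aX.
    by apply/rowP => j; exact: (h j I).
  apply: closed_bigI => j _.
  apply: (preimage_closed _ (@closed_eq _ (y ord0 j))) => a _.
  have -> : (fun a : 'rV[R]_N => (a *m X) ord0 j) =
      (fun a => \sum_i a ord0 i * X i j) by apply/funext => b; rewrite mxE.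
  apply: (@continuous_sum _ _ _ _ (fun i (b : 'rV[R]_N) => b ord0 i * X i j)) => i.
  apply: (@continuousM _ _ (fun b : 'rV[R]_N => b ord0 i) (fun=> X i j)).
    exact: coord_continuous.
  exact: cst_continuous.
have bdK : bounded_set K.
  exists M; split; first exact: num_real.
  by move=> M' /ltW MM' a [_ /= aM]; rewrite (le_trans _ MM') // (le_trans (norm_le_l1 a)).
have [|a] := EVT_min_rV (ex_intro _ _ yK) (bounded_closed_compact bdK clK) (f := @l1 R N).
  by apply: continuous_subspaceT; exact: continuous_l1.
rewrite inE => -[/= aX aM] amin; exists a => //.
apply/eqP; rewrite eq_le -{2}aX hull_norm_le andbT.
apply: lb_le_inf; first by exists (l1 a), a.
move=> _ [b /= bX <-].
have [bM|/ltW Mb] := lerP (l1 b) M; first by apply: amin; rewrite inE.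
exact: le_trans Mb.
Qed.

Lemma hull_norm_is_norm X (L : 'M[R]_(n, N)) : L *m X = 1%:M -> is_norm (hull_norm X).
Proof.
move=> LX.
have att y := hull_norm_attained y LX.
(* One inequality is enough: applied to [c^-1] it yields the converse. *)
have leZ c y : hull_norm X (c *: y) <= `|c| * hull_norm X y.
  by have [a <- <-] := att y; rewrite scalemxAl -l1Z hull_norm_le.
split=> [y y0|c y|y z].
- by have [a aX] := att y; rewrite y0 => /l1_eq0 a0; rewrite -aX a0 mul0mx.
- apply/eqP; rewrite eq_le leZ /=; have [->|c0] := eqVneq c 0.
    rewrite normr0 mul0r scale0r; have [a _ <-] := att 0; exact: l1_ge0.
  have := leZ c^-1 (c *: y); rewrite scalerA mulVf // scale1r normfV.
  by rewrite ler_pdivlMl // normr_gt0.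
- have [a <- <-] := att y; have [b <- <-] := att z.
  by rewrite -mulmxDl; apply: le_trans (hull_norm_le _ _) (l1D _ _).
Qed.

Lemma hull_norm_ball X (L : 'M[R]_(n, N)) : L *m X = 1%:M -> (0 < N)%N ->
  symmetric_hull (fun i => row i X) = [set y | hull_norm X y <= 1].
Proof.
move=> LX N0; rewrite symmetric_hullE //; apply/seteqP; split => y /=.
  by move=> [a a1 ->]; apply: le_trans a1; exact: hull_norm_le.
by have [a <- <-] := hull_norm_attained y LX; exists a.
Qed.

Section UnitBall.
Variables (X : 'M[R]_(N, n)) (nu : 'rV[R]_n -> R).
Hypothesis N0 : (0 < N)%N.
Hypothesis nuN : is_norm nu.
Hypothesis nuX : symmetric_hull (fun i => row i X) = [set y | nu y <= 1].

Lemma is_norm0 : nu 0 = 0.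
Proof. by have := norm_homogeneous nuN 0 0; rewrite scale0r normr0 mul0r. Qed.

Lemma is_norm_ge0 y : 0 <= nu y.
Proof.
have := norm_triangle nuN y (- y); rewrite subrr is_norm0.
have -> : nu (- y) = nu y.
  by rewrite -scaleN1r (norm_homogeneous nuN) normrN normr1 mul1r.
by rewrite -mulr2n pmulrn_lge0.
Qed.

Lemma nu_le_l1 a : nu (a *m X) <= l1 a.
Proof.
rewrite mulmx_sum_row /l1; elim/big_ind2 : _ => [|x1 x2 y1 y2 h1 h2|i _].
- by rewrite is_norm0.
- by apply: le_trans (norm_triangle nuN _ _) _; exact: lerD.
rewrite (norm_homogeneous nuN) ler_piMr //.
have : symmetric_hull (fun i => row i X) (row i X).
  by move=> C [_]; apply; exists i; left.
by rewrite nuX.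
Qed.

Lemma nu_le_exists y (s : R) : 0 < s -> nu y <= s ->
  exists2 a, l1 a <= s & y = a *m X.
Proof.
move=> s0 ys.
have : symmetric_hull (fun i => row i X) (s^-1 *: y).
  rewrite nuX /= (norm_homogeneous nuN) gtr0_norm ?invr_gt0 //.
  by rewrite ler_pdivrMl // mulr1.
rewrite symmetric_hullE // => -[a a1 /(congr1 ( *:%R s))].
rewrite scalerA divff ?gt_eqF // scale1r => ->; exists (s *: a).
  by rewrite l1Z gtr0_norm // -[leRHS]mulr1 ler_pM2l.
by rewrite -scalemxAl.
Qed.

Lemma spanning : exists L : 'M[R]_(n, N), L *m X = 1%:M.
Proof.
have : forall j : 'I_n, exists a : 'rV[R]_N, a *m X = delta_mx ord0 j.
  move=> j; have [||a _ ->] := @nu_le_exists (delta_mx ord0 j) (1 + nu (delta_mx ord0 j)).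
  - by rewrite ltr_pwDl // is_norm_ge0.
  - by rewrite lerDr.
  - by exists a.
move=> /fin_all_exists[a aX]; exists (\matrix_j a j).
by apply/row_matrixP => j; rewrite row_mul rowK aX row1.
Qed.

(** The ball is the hull of the signed points, so the images of the points decide the norm. Writing
    each image with short coefficients replaces the supremum by finitely many strict inequalities, a
    condition stable under perturbation of the points. *)
Lemma operator_norm_lt (P : 'End('rV[R]_n)) (r : R) :
  operator_norm nu P < r <->
  exists A : 'M[R]_N, (forall i, P (row i X) = row i A *m X) /\
    forall i, l1 (row i A) < r.
Proof.
pose S := [set nu (P y) | y in [set y | nu y <= 1]].
have S0 : S !=set0 by exists (nu (P 0)), 0 => //=; rewrite is_norm0.
have bound (A : 'M[R]_N) s : (forall i, P (row i X) = row i A *m X) ->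
    (forall i, l1 (row i A) <= s) -> ubound S s.
  move=> AX As _ [y /= y1 <-].
  have [a a1 ->] := nu_le_exists ltr01 y1.
  have -> : P (a *m X) = (a *m A) *m X.
    rewrite mulmx_sum_row linear_sum -mulmxA mulmx_sum_row; apply: eq_bigr => i _.
    by rewrite linearZ /= AX row_mul.
  apply: le_trans (nu_le_l1 _) _; apply: le_trans (l1_mulmx a As) _.
  have s0 : 0 <= s := le_trans (l1_ge0 _) (As (Ordinal N0)).
  by rewrite ler_piMl.
split => [Pr|[A [AX Ar]]].
  (* [sup] is an upper bound only for a bounded set. The points span, so their images have some
     coefficients, whose total length is a bound. *)
  have supS : has_sup S.
    split=> //.
    have : forall i : 'I_N, exists a : 'rV[R]_N, P (row i X) = a *m X.
      move=> i; have [||a _ ->] := @nu_le_exists (P (row i X)) (1 + nu (P (row i X))).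
      - by rewrite ltr_pwDl // is_norm_ge0.
      - by rewrite lerDr.
      - by exists a.
    move=> /fin_all_exists[a aX].
    exists (\sum_i l1 (a i)); apply: (bound (\matrix_i a i)) => i; rewrite rowK //.
    by rewrite (bigD1 i) //= lerDl sumr_ge0 // => k _; exact: l1_ge0.
  (* A value strictly above the operator norm is positive even if that norm is 0, as [nu_le_exists]
     requires, and still leaves the strict inequality with [r]. *)
  pose s := (operator_norm nu P + r) / 2.
  have [sP sr] : operator_norm nu P < s /\ s < r by rewrite /s; split; lra.
  have nuP i : nu (P (row i X)) <= operator_norm nu P.
    apply: ub_le_sup; first exact: supS.2.
    exists (row i X) => //=.
    suff : symmetric_hull (fun i => row i X) (row i X) by rewrite nuX.
    by move=> C [_]; apply; exists i; left.
  have s0 : 0 < s by apply: le_lt_trans sP; exact: le_trans (is_norm_ge0 _) (nuP (Ordinal N0)).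
  have : forall i, exists a : 'rV[R]_N, P (row i X) = a *m X /\ l1 a <= s.
    move=> i; have [a ha ->] := nu_le_exists s0 (le_trans (nuP i) (ltW sP)).
    by exists a.
  move=> /fin_all_exists[a aX]; exists (\matrix_i a i).
  split=> i; rewrite rowK; first exact: (aX i).1.
  exact: le_lt_trans (aX i).2 sr.
pose s := \big[Num.max/0]_i l1 (row i A).
have sr : s < r.
  apply/bigmax_ltP; split=> //.
  by apply: le_lt_trans (Ar (Ordinal N0)); exact: l1_ge0.
apply: le_lt_trans sr; apply: sup_le_ub => //; apply: (bound A) => // i.
exact: le_bigmax.
Qed.

End UnitBall.

End Hull.

(** The kernel is a line containing every [x - P x], so [x - P x] is a linear functional of [x]
    times a generator [v0]; the functional is read off at a coordinate where [v0] does not vanish.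
    Rescaling [f] and [v] inversely makes [f] a unit vector. *)
Lemma hyperplane_projectionE (R : realType) n (P : 'End('rV[R]_n)) :
  hyperplane_projection P ->
  exists f v, [/\ dot v f = 1, dot f f = 1 & forall x, P x = x - dot x f *: v].
Proof.
move=> [PP dimP].
have kerE x : x - P x \in lker P.
  by rewrite memv_ker linearB /= -[P (P x)]comp_lfunE PP subrr.
have dimK : \dim (lker P) = 1%N.
  have := limg_ker_dim P fullv; rewrite capfv dimvf [RHS](mul1n n) => e.
  by apply: (@addIn (\dim (limg P))); rewrite e add1n dimP.
pose v0 := vpick (lker P).
have v00 : v0 != 0 by rewrite vpick0 -dimv_eq0 dimK.
have kerv : lker P = <[v0]>%VS.
  apply/esym/eqP; rewrite eqEdim dim_vline v00 dimK leqnn andbT.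
  by rewrite -memvE memv_pick.
have Pv0 : P v0 = 0 by apply/eqP; rewrite -memv_ker memv_pick.
have [j0 vj0] : exists j, v0 ord0 j != 0.
  apply/existsP; apply: contraNT v00; rewrite negb_exists => /forallP h.
  by apply/eqP/rowP => j; rewrite mxE; apply/eqP; rewrite -[_ == _]negbK h.
pose f0 := \row_j ((delta_mx ord0 j - P (delta_mx ord0 j)) ord0 j0 / v0 ord0 j0).
have cE x : dot x f0 = (x - P x) ord0 j0 / v0 ord0 j0.
  have xE : x - P x = \sum_j x ord0 j *: (delta_mx ord0 j - P (delta_mx ord0 j)).
    rewrite {1 2}(row_sum_delta x) linear_sum -sumrB; apply: eq_bigr => j _.
    by rewrite linearZ scalerBr.
  rewrite xE summxE mulr_suml; apply: eq_bigr => j _.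
  by rewrite !mxE mulrA.
have PE x : P x = x - dot x f0 *: v0.
  have := kerE x; rewrite kerv => /vlineP[c xc].
  rewrite cE xc mxE mulfK // -xc; by rewrite opprB addrC subrK.
have vf0 : dot v0 f0 = 1 by rewrite cE Pv0 subr0 divff.
have f00 : f0 != 0.
  by apply: contra_eq_neq vf0 => ->; rewrite dot0r eq_sym oner_neq0.
pose s := Num.sqrt (dot f0 f0).
have s0 : s != 0 by rewrite gt_eqF // sqrtr_gt0 dot_gt0.
exists (s^-1 *: f0), (s *: v0); split=> [||x].
- by rewrite dotZl dotZr vf0 mulr1 divff.
- exact: normalize.
- by rewrite dotZr scalerA mulrAC mulVf // mul1r PE.
Qed.

(** * Openness of the conditions defining the event *)

Section Events.
Variables (R : realType) (n N : nat) (r : R).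
Hypothesis N0 : (0 < N)%N.

Definition spanning_configurations : set 'M[R]_(N, n) :=
  [set X | exists L : 'M[R]_(n, N), L *m X = 1%:M].

(** For a spanning configuration this says that some hyperplane projection has operator norm less
    than [r], by [operator_norm_lt], without mention of a norm. *)
Definition good_projection (X : 'M[R]_(N, n)) : Prop :=
  exists (P : 'End('rV[R]_n)) (A : 'M[R]_N), [/\ hyperplane_projection P,
    forall i, P (row i X) = row i A *m X & forall i, l1 (row i A) < r].

Lemma hyperplane_projections_geE X :
  hyperplane_projections_ge (symmetric_hull (fun i => row i X)) r <->
  spanning_configurations X /\ ~ good_projection X.
Proof.
split=> [[nu [nuN nuX nuP]]|[[L LX] ngood]].
  split; first exact: spanning N0 nuN nuX.
  move=> [P [A [hP AX Ar]]].
  have := nuP P hP; rewrite leNgt => /negP; apply.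
  by apply/(operator_norm_lt N0 nuN nuX); exists A.
have nuN := hull_norm_is_norm LX; have nuX := hull_norm_ball LX N0.
exists (hull_norm X); split=> // P hP.
rewrite leNgt; apply/negP => /(operator_norm_lt N0 nuN nuX)[A [AX Ar]].
by apply: ngood; exists P, A.
Qed.

(* The left inverse near a configuration is rational in the configuration. *)
Definition left_inverse_near (L : 'M[R]_(n, N)) (Y : 'M[R]_(N, n)) :=
  (\det (L *m Y))^-1 *: \adj (L *m Y) *m L.

Lemma left_inverse_nearP L Y : \det (L *m Y) != 0 -> left_inverse_near L Y *m Y = 1%:M.
Proof.
move=> d0; rewrite /left_inverse_near -mulmxA -scalemxAl mul_adj_mx.
by rewrite scale_scalar_mx mulVf.
Qed.

Section Near.
Variables (X : 'M[R]_(N, n)) (L : 'M[R]_(n, N)).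
Hypothesis LX : L *m X = 1%:M.

Lemma entries_continuous_id : entries_continuous X id.
Proof. by move=> i j; exact: coord_continuous. Qed.

Lemma continuous_det_left : {for X, continuous (fun Y => \det (L *m Y))}.
Proof.
apply: continuous_det; apply: entries_continuousM; last exact: entries_continuous_id.
exact: entries_continuous_cst.
Qed.

Lemma near_det_left : \forall Y \near X, \det (L *m Y) != 0.
Proof.
have : \det (L *m X) != 0 by rewrite LX det1 oner_neq0.
by move=> d0; apply: (cvgr_neq0 _ continuous_det_left d0).
Qed.

Lemma entries_continuous_left_inverse : entries_continuous X (left_inverse_near L).
Proof.
apply: entries_continuousM; last exact: entries_continuous_cst.
apply: entries_continuousZ.
  apply: continuousV; first by rewrite LX det1 oner_neq0.
  exact: continuous_det_left.
apply: entries_continuous_adj; apply: entries_continuousM.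
  exact: entries_continuous_cst.
exact: entries_continuous_id.
Qed.

End Near.

Lemma open_spanning : open spanning_configurations.
Proof.
rewrite openE => X [L LX]; rewrite /interior.
near=> Y; exists (left_inverse_near L Y); apply: left_inverse_nearP.
by near: Y; exact: near_det_left.
Unshelve. all: by end_near. Qed.

(** The projection stays fixed while the configuration moves to [Y]. Adding to [A] the error
    [Y P - A Y] times a left inverse of [Y] gives exact coefficients [G Y], continuous in [Y] and
    equal to [A] at [X]. *)
Lemma open_good_projection : open (spanning_configurations `&` good_projection).
Proof.
rewrite openE => X [[L LX] [P [A [hP AX Ar]]]]; rewrite /interior.
pose G (Y : 'M[R]_(N, n)) : 'M[R]_N :=
  A + (Y *m lin1_mx P - A *m Y) *m left_inverse_near L Y.
have PE y : y *m lin1_mx P = P y by exact: mul_rV_lin1.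
have GX : G X = A.
  rewrite /G (_ : X *m lin1_mx P - A *m X = 0) ?mul0mx ?addr0 //.
  apply/row_matrixP => i; rewrite linearB /= !row_mul PE AX subrr.
  by rewrite row0.
have cG : entries_continuous X G.
  apply: entries_continuousD; first exact: entries_continuous_cst.
  apply: entries_continuousM; last exact: entries_continuous_left_inverse.
  apply: entries_continuousB; apply: entries_continuousM;
    by [exact: entries_continuous_cst | exact: entries_continuous_id].
have cl1 i : {for X, continuous (fun Y => l1 (row i (G Y)))}.
  apply: (@continuous_sum _ _ _ _ (fun j Y => `|row i (G Y) ord0 j|)) => j.
  have -> : (fun Y => `|row i (G Y) ord0 j|) = (fun Y => `|G Y i j|).
    by apply/funext => Y; rewrite mxE.
  apply: (@continuous_comp _ _ _ (fun Y => G Y i j)); first exact: cG.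
  exact: norm_continuous.
have nl1 : \forall Y \near X, forall i, l1 (row i (G Y)) < r.
  apply: (@filter_forall _ _ (fun i Y => l1 (row i (G Y)) < r) (nbhs X)) => i.
  have : l1 (row i (G X)) < r by rewrite GX.
  by move=> h; apply: (cvgr_lt _ (cl1 i) _ h).
near=> Y.
have LY : left_inverse_near L Y *m Y = 1%:M.
  by apply: left_inverse_nearP; near: Y; exact: near_det_left.
split; first by exists (left_inverse_near L Y).
exists P, (G Y); split=> // i; last by move: i; near: Y.
rewrite -PE -row_mul -row_mul; congr (row i _).
by rewrite /G [RHS]mulmxDl -(mulmxA _ (left_inverse_near L Y)) LY mulmx1 addrC subrK.
Unshelve. all: by end_near. Qed.

End Events.

(** An open set of matrices is a countable union of boxes with rational corners, and the preimage of
    a box is a finite intersection of conditions on single entries. *)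
Lemma measurable_preimage_open (d : measure_display) (T : measurableType d)
    (R : realType) m n (F : T -> 'M[R]_(m, n)) (U : set 'M[R]_(m, n)) :
  (forall i j, measurable_fun setT (fun t => F t i j)) -> open U ->
  measurable (F @^-1` U).
Proof.
move=> mF oU.
pose box (q : 'M[rat]_(m, n) * 'M[rat]_(m, n)) : set 'M[R]_(m, n) :=
  [set Y | forall i j, Y i j \in `]ratr (q.1 i j), ratr (q.2 i j)[].
have -> : F @^-1` U = \bigcup_(q : 'M[rat]_(m, n) * 'M[rat]_(m, n))
    (F @^-1` box q `&` [set t | box q `<=` U]).
  apply/seteqP; split => [t Ut|t [q _ [bq]]]; last by move=> /= /(_ _ bq).
  have := oU; rewrite openE => /(_ _ Ut) /nbhs_ballP[e /= e0 eU].
  have /fin_all_exists[a aP] : forall p : 'I_m * 'I_n, exists q : rat * rat,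
      F t p.1 p.2 - e < ratr q.1 < F t p.1 p.2 /\
      F t p.1 p.2 < ratr q.2 < F t p.1 p.2 + e.
    move=> p; have [|q1] := @rat_in_itvoo R (F t p.1 p.2 - e) (F t p.1 p.2).
      by rewrite gtrBl.
    have [|q2] := @rat_in_itvoo R (F t p.1 p.2) (F t p.1 p.2 + e).
      by rewrite ltrDl.
    by rewrite !in_itv /= => h2 h1; exists (q1, q2).
  exists (\matrix_(i, j) (a (i, j)).1, \matrix_(i, j) (a (i, j)).2) => //.
  split=> [i j|Y bY].
    have [/andP[_ h1] /andP[h2 _]] := aP (i, j).
    by rewrite !mxE in_itv /= h1.
  apply: eU; split => // i j; have := bY i j; rewrite !mxE in_itv /= => /andP[Y1 Y2].
  have [/andP[h1 _] /andP[_ h2]] := aP (i, j); rewrite /= in h1 h2.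
  rewrite /ball /= ltr_norml; apply/andP; split; lra.
apply: countable_bigcupT_measurable => [|q]; first exact: countableP.
have [bU|nbU] := pselect (box q `<=` U); last first.
  by rewrite (_ : _ `&` _ = set0) // -subset0 => t [].
rewrite (_ : _ `&` _ = F @^-1` box q); last by apply/setIidPl => t _.
have -> : F @^-1` box q = \bigcap_(p : 'I_m * 'I_n)
    ((fun t => F t p.1 p.2) @^-1` `]ratr (q.1 p.1 p.2), ratr (q.2 p.1 p.2)[).
  by apply/seteqP; split => [t h [i j] _|t h i j]; [exact: h | exact: (h (i, j))].
apply: fin_bigcap_measurable => // p _.
by rewrite -[X in measurable X]setTI; exact: mF.
Qed.

(** * The uniform distribution on the sphere *)

Section Counting.
Context (d : measure_display) (T : measurableType d) (R : realType).
Variable P : probability T R.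

Lemma fine_probability (A : set T) : measurable A -> P A = (fine (P A))%:E.
Proof. by move=> mA; rewrite fineK // fin_num_measure. Qed.

Lemma union_bound (I : finType) (A : I -> set T) (B : set T) (c : R) :
  measurable B -> (forall i, measurable (A i)) ->
  (forall i, (P (A i) <= c%:E)%E) -> (forall t, B t -> exists i, A i t) ->
  (P B <= (#|I|%:R * c)%:E)%E.
Proof.
move=> mB mA Ac BA.
have mU (r : seq I) : measurable (\big[setU/set0]_(i <- r) A i).
  by elim/big_ind : _ => // X Y; exact: measurableU.
have PU (r : seq I) : (P (\big[setU/set0]_(i <- r) A i) <= ((size r)%:R * c)%:E)%E.
  elim: r => [|i r IH]; first by rewrite big_nil measure0 mul0r.
  rewrite big_cons /= -natr1 mulrDl mul1r EFinD addeC.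
  exact: le_trans (measureU2 _ (mA i) (mU r)) (leeD (Ac i) IH).
have := PU (enum I); rewrite -cardE cardT; apply: le_trans.
apply: le_measure; rewrite ?inE // => t /BA[i Ait].
have : i \in enum I by rewrite mem_enum.
elim: (enum I) => // j r IH; rewrite inE big_cons => /orP[/eqP<-|ir]; first by left.
by right; exact: IH.
Qed.

(** The sum of the probabilities is the integral of the number of events that occur, which never
    exceeds [L]. *)
Lemma overlap_bound (I : finType) (A : I -> set T) (L : nat) (c : R) :
  (forall i, measurable (A i)) -> (forall i, P (A i) = c%:E) ->
  (forall t, (#|[set i | `[< A i t >]]%SET| <= L)%N) -> #|I|%:R * c <= L%:R.
Proof.
move=> mA PA AL; rewrite -lee_fin.
have -> : (#|I|%:R * c)%:E = (\sum_(i <- enum I) P (A i))%E.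
  by rewrite (eq_bigr (fun=> c%:E)) // sumEFin big_enum /= sumr_const mulr_natl.
rewrite (eq_bigr (fun i => \int[P]_(x in setT) (\1_(A i) x)%:E)%E); last first.
  by move=> i _; rewrite integral_indic // setIT.
rewrite -ge0_integral_sum //; last first.
  by move=> i; apply/measurable_EFinP; exact: measurable_indic.
have -> : L%:R%:E = (\int[P]_(x in setT) (cst L%:R%:E x))%E.
  by rewrite integral_cst // -[LHS]mule1; congr (_ * _)%E; rewrite -(probability_setT P).
apply: ge0_le_integral => //.
- by move=> x _; apply: sume_ge0 => i _; rewrite lee_fin.
- by apply: emeasurable_sum => i; apply/measurable_EFinP; exact: measurable_indic.
move=> x _; rewrite sumEFin lee_fin /=.
apply: (@le_trans _ _ #|[set i | `[< A i x >]]%SET|%:R); last by rewrite ler_nat.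
rewrite big_enum /= -sum1_card natr_sum [leRHS]big_mkcond /=.
apply: ler_sum => i _; rewrite indicE !inE.
by case: asboolP => Aix; [rewrite mem_set | rewrite memNset].
Qed.

End Counting.

Section Sphere.
Variables (R : realType) (n : nat).
Implicit Types (u v x : 'rV[R]_n).
Notation Rn := (borel_rV R n).

Lemma measurable_closed (C : set 'rV[R]_n) : closed C -> measurable (C : set Rn).
Proof.
move=> cC; rewrite -[C]setCK; apply: measurableC.
by apply: sub_sigma_algebra; exact: closed_openC.
Qed.

Lemma closed_le_continuous (f : 'rV[R]_n -> R) a : continuous f ->
  closed [set x | f x <= a].
Proof. by move=> cf; apply: (preimage_closed _ (@closed_le _ a)) => x _; exact: cf. Qed.

Lemma continuous_dot u : continuous (fun x => dot x u).
Proof.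
move=> x; apply: (@continuous_sum _ _ _ _ (fun j x => x ord0 j * u ord0 j)) => j.
apply: (@continuousM _ _ (fun x : 'rV[R]_n => x ord0 j) (fun=> u ord0 j)).
  exact: coord_continuous.
exact: cst_continuous.
Qed.

Lemma continuous_sqr_norm : continuous (fun x => dot x x).
Proof.
move=> x; apply: (@continuous_sum _ _ _ _ (fun j x => x ord0 j * x ord0 j)) => j.
by apply: (@continuousM _ _ (fun x : 'rV[R]_n => x ord0 j)); exact: coord_continuous.
Qed.

Lemma closed_slab u t delta : closed [set x | `|dot x u - t| <= delta].
Proof.
apply: closed_le_continuous => x.
apply: (@continuous_comp _ _ _ (fun x : 'rV[R]_n => dot x u - t)); last exact: norm_continuous.
by apply: (@continuousB _ _ _ (fun x : 'rV[R]_n => dot x u) (fun=> t));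
  [exact: continuous_dot | exact: cst_continuous].
Qed.

Lemma closed_cap (c : 'rV[R]_n) s : closed [set x | dot (x - c) (x - c) <= s].
Proof.
apply: closed_le_continuous => x.
apply: (@continuous_comp _ _ _ (fun x : 'rV[R]_n => x - c) (fun y => dot y y));
  last exact: continuous_sqr_norm.
by apply: (@continuousB _ _ _ id (fun=> c)); [exact: cvg_id | exact: cst_continuous].
Qed.

Lemma closed_ring u v rho2 : closed [set x | rho2 <= dot x u ^+ 2 + dot x v ^+ 2].
Proof.
have -> : [set x | rho2 <= dot x u ^+ 2 + dot x v ^+ 2] =
    [set x | - (dot x u * dot x u + dot x v * dot x v) <= - rho2].
  by apply/seteqP; split=> x /=; rewrite lerN2 !expr2.
apply: closed_le_continuous => x.
apply: (@continuousN _ _ _ (fun x : 'rV[R]_n => dot x u * dot x u + dot x v * dot x v)).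
apply: (@continuousD _ _ _ (fun x : 'rV[R]_n => dot x u * dot x u)
  (fun x : 'rV[R]_n => dot x v * dot x v)).
  by apply: (@continuousM _ _ (fun x : 'rV[R]_n => dot x u)); exact: continuous_dot.
by apply: (@continuousM _ _ (fun x : 'rV[R]_n => dot x v)); exact: continuous_dot.
Qed.

Lemma unit_sphereE : @unit_sphere R n = [set x | dot x x = 1].
Proof.
have normE x : euclidean_norm x = Num.sqrt (dot x x).
  by congr Num.sqrt; apply: eq_bigr => j _; rewrite expr2.
apply/seteqP; split=> x; rewrite /unit_sphere /= normE => h; last by rewrite h sqrtr1.
by rewrite -[LHS]sqr_sqrtr ?dot_ge0 // h expr1n.
Qed.

Lemma closed_sphere : closed [set x : 'rV[R]_n | dot x x = 1].
Proof.
apply: (preimage_closed _ (@closed_eq _ 1)) => x _; exact: continuous_sqr_norm.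
Qed.

(** The reflection along [u - v] exchanges the two unit vectors; when they are equal it is the
    identity. *)
Lemma reflection u v : dot u u = 1 -> dot v v = 1 ->
  exists U : 'M[R]_n, [/\ U *m U^T = 1%:M,
    forall x, dot (x *m U) u = dot x v & forall x, dot (x *m U) (x *m U) = dot x x].
Proof.
move=> u1 v1; exists (householder (u - v)).
have orth := householder_orthogonal (u - v).
have normU x : dot (x *m householder (u - v)) (x *m householder (u - v)) = dot x x.
  have := mulmx_tr_dot (x *m householder (u - v)) (x *m householder (u - v)).
  rewrite trmx_mul mulmxA -(mulmxA x) orth mulmx1 mulmx_tr_dot.
  by move=> /matrixP/(_ ord0 ord0); rewrite !mxE.
split=> // x; have [->|uv] := eqVneq u v.
  by rewrite dot_householder subrr !(dot0l, dot0r) mulr0 subr0.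
have w0 : dot (u - v) (u - v) != 0 by rewrite dot_eq0 subr_eq0.
have wE : dot (u - v) (u - v) = 2 * dot (u - v) u.
  by rewrite !(dotBl, dotBr) (dotC v u) u1 v1; ring.
rewrite dot_householder (dotBr u v x); rewrite wE in w0 *.
by field; move: w0; rewrite mulf_eq0 negb_or => /andP[_ ->].
Qed.

End Sphere.

Section UniformOnSphere.
Variables (R : realType) (n : nat) (mu : probability (borel_rV R n) R).
Hypothesis hmu : uniform_on_sphere mu.
Implicit Types (u v x : 'rV[R]_n).

Lemma uniform_sphere : mu [set x : 'rV[R]_n | dot x x = 1] = 1%E.
Proof. by rewrite -unit_sphereE; exact: hmu.1. Qed.

Lemma uniform_le_sphere (A : set (borel_rV R n)) : measurable A ->
  (mu A <= mu (A `&` [set x : 'rV[R]_n | dot x x = 1%R]))%E.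
Proof.
move=> mA; set S := [set x : 'rV[R]_n | _].
have mS : measurable (S : set (borel_rV R n)) by apply: measurable_closed; exact: closed_sphere.
have -> : mu (A `&` S) = (mu (A `&` S) + mu (~` S))%E.
  by rewrite probability_setC // uniform_sphere subee // adde0.
apply: le_trans (measureU2 _ _ _); last 2 first.
- exact: measurableI.
- exact: measurableC.
apply: le_measure; rewrite ?inE //.
- by apply: measurableU; [exact: measurableI | exact: measurableC].
- by move=> x Ax; have [Sx|nSx] := pselect (S x); [left | right].
Qed.

Lemma uniform_slab_eq u v t delta : dot u u = 1 -> dot v v = 1 ->
  mu [set x | `|dot x u - t| <= delta] = mu [set x | `|dot x v - t| <= delta].
Proof.
move=> u1 v1; have [U [UU Uu _]] := reflection u1 v1.
rewrite -(hmu.2 U _ UU); last by apply: measurable_closed; exact: closed_slab.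
by congr (mu _); apply/seteqP; split=> x /=; rewrite Uu.
Qed.

Lemma uniform_cap_eq u v s : dot u u = 1 -> dot v v = 1 ->
  mu [set x | dot (x - u) (x - u) <= s] = mu [set x | dot (x - v) (x - v) <= s].
Proof.
move=> u1 v1; have [U [UU Uu Ux]] := reflection u1 v1.
rewrite -(hmu.2 U _ UU); last by apply: measurable_closed; exact: closed_cap.
congr (mu _); apply/seteqP.
have e x : dot (x *m U - u) (x *m U - u) = dot (x - v) (x - v).
  by rewrite !(dotBl, dotBr) !(dotC u) !(dotC v) Uu Ux u1 v1.
by split=> x /=; rewrite e.
Qed.

End UniformOnSphere.

Section UniformOnSphere.
Variables (R : realType) (n : nat) (mu : probability (borel_rV R n) R).
Hypothesis hmu : uniform_on_sphere mu.
Implicit Types (u v x : 'rV[R]_n).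

(* The slab is reflected to [M] slabs with normals
   [(j / M) *: e1 + sqrt (1 - (j / M) ^+ 2) *: e2], whose mutual distances are at
   least [1 / M]; no point far from the orthogonal of the plane is in three. *)
Lemma pair_slab_bound (e1 e2 : 'rV[R]_n) (t delta rho2 : R) (M : nat) :
  dot e1 e1 = 1 -> dot e2 e2 = 1 -> dot e1 e2 = 0 -> (0 < M)%N -> 0 <= rho2 ->
  64 * delta ^+ 2 * M%:R ^+ 4 < rho2 ->
  (mu ([set x | (`|dot x e1 - t| <= delta)%R] `&`
       [set x | (rho2 <= dot x e1 ^+ 2 + dot x e2 ^+ 2)%R]) <= (2 / M%:R)%:E)%E.
Proof.
move=> e11 e22 e12 M0 rho0 small.
have M_gt0 : 0 < M%:R :> R by rewrite ltr0n.
pose c (j : 'I_M) : R := j%:R / M%:R.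
pose s j : R := Num.sqrt (1 - c j ^+ 2).
have c0 j : 0 <= c j by rewrite divr_ge0.
have c1 j : c j < 1 by rewrite ltr_pdivrMr // mul1r ltr_nat.
have cs j : c j ^+ 2 + s j ^+ 2 = 1.
  have h : 0 <= 1 - c j ^+ 2 by rewrite subr_ge0 expr_le1 ?c0 // ltW ?c1.
  by rewrite (sqr_sqrtr h) addrC subrK.
pose S (a b : 'rV[R]_n) : set 'rV[R]_n := [set x | `|dot x a - t| <= delta] `&`
  [set x | rho2 <= dot x a ^+ 2 + dot x b ^+ 2].
have mS a b : measurable (S a b : set (borel_rV R n)).
  by apply: measurable_closed; apply: closedI; [exact: closed_slab | exact: closed_ring].
pose u j := c j *: e1 + s j *: e2.
pose v j := s j *: e1 - c j *: e2.
(* The reflection exchanging [e1] and [u j] also takes [e2] to [v j], so it transports both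
   conditions at once; [c j < 1] keeps its direction [w] nonzero. *)
have muS j : mu (S (u j) (v j)) = mu (S e1 e2).
  have [w ww] : exists w, dot w w = 2 * (1 - c j) /\ w = e1 - u j.
    exists (e1 - u j); split=> //.
    rewrite /u !(dotBl, dotBr, dotDl, dotDr, dotZl, dotZr) e11 e22 e12 (dotC e2) e12.
    transitivity (1 - 2 * c j + (c j ^+ 2 + s j ^+ 2)); first by ring.
    by rewrite cs; ring.
  have [ww2 wE] := ww.
  have cj : 1 - c j != 0 by rewrite subr_eq0 gt_eqF.
  have we1 : dot w e1 = 1 - c j.
    by rewrite wE /u dotBl dotDl !dotZl e11 (dotC e2) e12; ring.
  have we2 : dot w e2 = - s j.
    by rewrite wE /u dotBl dotDl !dotZl e12 e22; ring.
  have xw x : dot x w = dot x e1 - dot x (u j) by rewrite wE dotBr.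
  have xu x : dot x (u j) = c j * dot x e1 + s j * dot x e2.
    by rewrite /u dotDr !dotZr.
  have s2 : s j ^+ 2 = (1 - c j) * (1 + c j).
    by rewrite -[RHS](addKr (c j ^+ 2)) -[LHS](addKr (c j ^+ 2)) cs; congr (_ + _); ring.
  have U1 x : dot (x *m householder w) e1 = dot x (u j).
    by rewrite dot_householder ww2 we1 xw; field.
  have U2 x : dot (x *m householder w) e2 = dot x (v j).
    rewrite dot_householder ww2 we2 xw xu /v dotBr !dotZr.
    transitivity (dot x e2 + s j * dot x e1 - s j ^+ 2 / (1 - c j) * dot x e2); first by field.
    by rewrite s2; field.
  rewrite -(hmu.2 _ _ (householder_orthogonal w) (mS e1 e2)).
  by congr (mu _); apply/seteqP; split=> x; rewrite /S /= U1 U2.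
have ring_uv j x : dot x (u j) ^+ 2 + dot x (v j) ^+ 2 = dot x e1 ^+ 2 + dot x e2 ^+ 2.
  rewrite /u /v dotDr dotBr !dotZr.
  transitivity ((c j ^+ 2 + s j ^+ 2) * (dot x e1 ^+ 2 + dot x e2 ^+ 2)); first by ring.
  by rewrite cs mul1r.
rewrite -/(S e1 e2) (fine_probability mu (mS e1 e2)) lee_fin ler_pdivlMr // mulrC.
have := @overlap_bound _ _ _ mu 'I_M (fun j => S (u j) (v j)) 2 (fine (mu (S e1 e2))).
rewrite card_ord; apply => [j|j|x]; first exact: mS.
  by rewrite muS; exact: fine_probability.
rewrite leqNgt; apply/negP => /card_gt2P[i [j [k [[]]]]].
rewrite !inE => -[xi ri] [xj _] [xk _] [ij jk ki].
have dist a b : a != b -> M%:R^-1 <= `|c a - c b|.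
  move=> ab; rewrite -mulrBl normrM [X in _ * X]gtr0_norm ?invr_gt0 //.
  rewrite ler_peMl ?invr_ge0 //.
  wlog ba : a b ab / (b < a)%N => [hw|].
    have [ltab|ltba|/val_inj e] := ltngtP a b; last by rewrite e eqxx in ab.
      by rewrite distrC; apply: hw; rewrite // eq_sym.
    exact: hw.
  rewrite ger0_norm ?subr_ge0 ?ler_nat ?(ltnW ba) //.
  by rewrite -natrB ?(ltnW ba) // ler1n subn_gt0.
have xuE a : dot x (u a) = dot x e1 * c a + dot x e2 * s a.
  by rewrite /u dotDr !dotZr ![_ * dot x _]mulrC.
have d0 : 0 < M%:R^-1 :> R by rewrite invr_gt0.
rewrite /= in xi xj xk ri; rewrite ring_uv in ri.
(* The roles are exchanged: the normals, given by [(c, s)], are the points of the unit circle, and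
   [x] supplies the normal of the slab containing them. *)
have := @three_points_in_slab R (c i) (s i) (c j) (s j) (c k) (s k)
  (dot x e1) (dot x e2) t delta M%:R^-1 rho2 (cs i) (cs j) (cs k) d0
  (dist _ _ ij) (dist _ _ jk) _ _ _ _ _.
rewrite -!xuE distrC => /(_ (dist _ _ ki) xi xj xk).
rewrite rho0 ri => /(_ erefl).
rewrite exprVn ler_pdivrMr ?exprn_gt0 // => h.
by have := lt_le_trans small h; rewrite ltxx.
Qed.

End UniformOnSphere.

(** Some coordinate of a unit vector has square at least [1 / n], so the vector is far from the
    orthogonal of one of the planes through [e ord0] and another [e k]. Each plane contributes
    [2 / M], by [pair_slab_bound] with [rho2 = 1 / n]. *)
Lemma uniform_slab_bound (R : realType) (n : nat) (mu : probability (borel_rV R n) R)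
    (u : 'rV[R]_n) (t delta : R) (M : nat) :
  uniform_on_sphere mu -> (1 < n)%N -> dot u u = 1 -> (0 < M)%N ->
  64 * n%:R * delta ^+ 2 * M%:R ^+ 4 < 1 ->
  (mu [set x | (`|dot x u - t| <= delta)%R] <= (2 * n%:R / M%:R)%:E)%E.
Proof.
move=> hmu; case: n mu hmu u => [|[|n]] // mu hmu u _ u1 M0 small.
pose e (k : 'I_n.+2) : 'rV[R]_n.+2 := delta_mx ord0 k.
have xe x k : dot x (e k) = x ord0 k.
  rewrite /dot (bigD1 k) //= mxE !eqxx mulr1 big1 ?addr0 // => j jk.
  by rewrite mxE (negbTE jk) andbF mulr0.
have ee k l : dot (e k) (e l) = (l == k)%:R by rewrite xe mxE eqxx.
rewrite (uniform_slab_eq hmu _ _ u1 (_ : dot (e ord0) (e ord0) = 1)); last by rewrite ee eqxx.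
set S := [set x : 'rV[R]_n.+2 | _].
have mS : measurable (S : set (borel_rV R n.+2)).
  by apply: measurable_closed; exact: closed_slab.
have n0 : 0 < n.+2%:R :> R by rewrite ltr0n.
apply: le_trans (uniform_le_sphere hmu mS) _.
pose A k : set 'rV[R]_n.+2 := if k == ord0 then set0 else
  S `&` [set x | n.+2%:R^-1 <= dot x (e ord0) ^+ 2 + dot x (e k) ^+ 2].
have := @union_bound _ _ _ mu 'I_n.+2 A
  (S `&` [set x : 'rV[R]_n.+2 | dot x x = 1]) (2 / M%:R).
rewrite card_ord mulrA [n.+2%:R * 2]mulrC; apply => [|k|k|x [Sx x1]].
- by apply: measurableI => //; apply: measurable_closed; exact: closed_sphere.
- rewrite /A; case: eqP => // _; apply: measurableI => //.
  by apply: measurable_closed; exact: closed_ring.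
- rewrite /A; have [_|k0] := eqVneq k ord0.
    by rewrite measure0 lee_fin divr_ge0.
  apply: pair_slab_bound => //; rewrite ?ee ?eqxx ?(negbTE k0) ?invr_ge0 //.
  by rewrite -[ltRHS]mul1r ltr_pdivlMr //; move: small; congr (_ < _); ring.
- have [k xk] : exists k, n.+2%:R^-1 <= x ord0 k ^+ 2.
    apply: contrapT => h.
    have := ltxx (1 : R); rewrite -{1}x1.
    have -> : 1 = \sum_(k < n.+2) n.+2%:R^-1 :> R.
      by rewrite sumr_const card_ord -[_ *+ _]mulr_natr mulVf // gt_eqF.
    move/negP; apply; apply: ltr_sum => [|k _].
      by apply/hasP; exists ord0; rewrite ?mem_index_enum.
    by rewrite -expr2 ltNge; apply/negP => xk; apply: h; exists k.
  (* If the large coordinate is that of [e ord0], which lies in all the planes, any of them will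
     do. *)
  have [k0|k0] := eqVneq k ord0.
    exists (lift ord0 ord0); rewrite /A /=; split=> //=.
    by rewrite !xe -k0 ler_wpDr // sqr_ge0.
  by exists k; rewrite /A (negbTE k0); split=> //=; rewrite !xe ler_wpDl // sqr_ge0.
Qed.

Lemma grid_cell (R : realType) (m : nat) (x : R) : (0 < m)%N -> `|x| <= 1 ->
  exists j : 'I_m, j%:R <= (x + 1) * m%:R / 2 <= j.+1%:R.
Proof.
move=> m0; rewrite ler_norml => /andP[x1 x2].
have m_gt0 : 0 < m%:R :> R by rewrite ltr0n.
set y := _ / 2.
have y0 : 0 <= y by rewrite divr_ge0 // mulr_ge0 //; lra.
have ym : y <= m%:R.
  by rewrite ler_pdivrMr // mulrC ler_pM2l //; lra.
have /andP[ky yk] := truncn_itv y0.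
have [km|mk] := ltnP (Num.truncn y) m.
  by exists (Ordinal km); rewrite /= ky ltW.
(* The endpoint [x = 1] has truncation [m] and is put in the last cell. *)
have m1 : (m.-1 < m)%N by rewrite prednK.
exists (Ordinal m1); rewrite /= prednK // ym andbT.
apply: le_trans ky; rewrite ler_nat; exact: leq_trans (leq_pred m) mk.
Qed.

(** The centers are taken on the sphere, one in each grid cell that meets it and an arbitrary unit
    vector for the other cells. Two points of a cell differ by at most [2 / m] in each
    coordinate. *)
Lemma sphere_net (R : realType) (n m : nat) : (0 < n)%N -> (0 < m)%N ->
  exists c : {ffun 'I_n -> 'I_m} -> 'rV[R]_n, (forall q, dot (c q) (c q) = 1) /\
    forall x, dot x x = 1 -> exists q,
      dot (x - c q) (x - c q) <= 4 * n%:R / m%:R ^+ 2.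
Proof.
move=> n0 m0; have m_gt0 : 0 < m%:R :> R by rewrite ltr0n.
pose cell (q : {ffun 'I_n -> 'I_m}) (x : 'rV[R]_n) := forall l,
  (q l)%:R <= (x ord0 l + 1) * m%:R / 2 <= (q l).+1%:R.
have [e e1] : exists e : 'rV[R]_n, dot e e = 1.
  exists (delta_mx ord0 (Ordinal n0)).
  rewrite /dot (bigD1 (Ordinal n0)) //= mxE !eqxx mulr1 big1 ?addr0 // => j jk.
  by rewrite mxE (negbTE jk) andbF mulr0.
have /choice[c cP] : forall q, exists c, dot c c = 1 /\
    forall x, dot x x = 1 -> cell q x -> cell q c.
  move=> q; have [[x [x1 qx]]|h] := pselect (exists x, dot x x = 1 /\ cell q x).
    by exists x; split.
  by exists e; split=> // x x1 qx; case: h; exists x.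
exists c; split=> [q|x x1]; first by case: (cP q).
have xle l : `|x ord0 l| <= 1.
  rewrite -[leRHS]ger0_norm // -ler_sqr ?nnegrE // !real_normK ?num_real // expr1n.
  rewrite -x1 /dot (bigD1 l) //= -expr2 lerDl.
  by apply: sumr_ge0 => j _; rewrite -expr2 sqr_ge0.
have /fin_all_exists[j jx] := fun l => grid_cell m0 (xle l).
pose q : {ffun 'I_n -> 'I_m} := [ffun l => j l].
have qx : cell q x by move=> l; rewrite ffunE.
have qc := (cP q).2 x x1 qx.
exists q; rewrite /dot; apply: (@le_trans _ _ (\sum_(l < n) 4 / m%:R ^+ 2)); last first.
  by rewrite sumr_const card_ord -[_ *+ n]mulr_natr mulrAC.
apply: ler_sum => l _; rewrite !mxE -expr2.
have /andP[x2 x3] := qx l; have /andP[c2 c3] := qc l.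
rewrite ler_pdivlMr ?exprn_gt0 // -exprMn.
have h : `|(x ord0 l - c q ord0 l) * m%:R| <= 2.
  have aux (a b k M : R) : k <= (a + 1) * M / 2 -> (a + 1) * M / 2 <= k + 1 ->
      k <= (b + 1) * M / 2 -> (b + 1) * M / 2 <= k + 1 -> `|(a - b) * M| <= 2.
    by rewrite ler_norml => h1 h2 h3 h4; apply/andP; split; lra.
  by apply: (aux _ _ (q l)%:R); rewrite ?natr1.
have -> : 4 = 2 ^+ 2 :> R by ring.
by rewrite -(real_normK (num_real (_ * _))) ler_sqr ?nnegrE.
Qed.

(** The [m ^ n] caps around the net cover the sphere and have equal measure by rotation
    invariance. *)
Lemma uniform_cap_bound (R : realType) (n m : nat)
    (mu : probability (borel_rV R n) R) (u : 'rV[R]_n) :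
  uniform_on_sphere mu -> (0 < n)%N -> (0 < m)%N -> dot u u = 1 ->
  ((m ^ n)%:R^-1%:E <=
    mu [set x | (dot (x - u) (x - u) <= 4 * n%:R / m%:R ^+ 2)%R])%E.
Proof.
move=> hmu n0 m0 u1.
have [c [c1 cover]] := sphere_net R n0 m0.
set s := 4 * n%:R / m%:R ^+ 2 in cover *.
have mcap v : measurable ([set x | dot (x - v) (x - v) <= s] : set (borel_rV R n)).
  by apply: measurable_closed; exact: closed_cap.
have K0 : 0 < (m ^ n)%:R :> R by rewrite ltr0n expn_gt0 m0.
have := @union_bound _ _ _ mu {ffun 'I_n -> 'I_m}
  (fun q => [set x | dot (x - c q) (x - c q) <= s])
  [set x : 'rV[R]_n | dot x x = 1]
  (fine (mu [set x | dot (x - u) (x - u) <= s])).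
rewrite card_ffun !card_ord uniform_sphere // => h.
rewrite (fine_probability mu (mcap u)) lee_fin -[leLHS]mulr1 ler_pdivrMl //.
rewrite -lee_fin; apply: h => [|q|q|x /cover //].
- by apply: measurable_closed; exact: closed_sphere.
- exact: mcap.
- by rewrite -(fine_probability mu (mcap u)) (uniform_cap_eq hmu _ (c1 q) u1).
Qed.

(** * Independence and bad events *)

Section Independence.
Context (d d' : measure_display) (T : measurableType d) (T' : measurableType d').
Context (R : realType) (P : probability T R) (I : finType) (X : I -> {RV P >-> T'}).
Hypothesis indX : mutually_independent X.
Variable i : I.

(** A family closed under intersection on which mutual independence gives the product formula
    directly; it generates the sigma-algebra [others]. *)
Definition cylinders : set (set T) :=
  [set C | exists2 A : I -> set T', (forall j, measurable (A j)) &
    C = \bigcap_(j in [set j | j \in [set~ i]%SET]) X j @^-1` A j].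

(* The sigma-algebra of the events that do not depend on [X i]. *)
Definition others : measurableType _ := g_sigma_algebraType cylinders.

Lemma cylinders_measurable : cylinders `<=` measurable.
Proof.
move=> _ [A mA ->]; apply: fin_bigcap_measurable => [|j _]; first exact: finite_finset.
by rewrite -[X in measurable X]setTI; apply: measurable_funPT.
Qed.

Lemma measurable_others (C : set others) : measurable C -> measurable (C : set T).
Proof. by apply: smallest_sub; [exact: sigma_algebra_measurable | exact: cylinders_measurable]. Qed.

(** For fixed [B] both sides are finite measures in [C] that agree on the cylinders, hence on the
    generated sigma-algebra. *)
Lemma independent_others (C : set others) (B : set T') : measurable C -> measurable B ->
  P (C `&` X i @^-1` B) = (P C * P (X i @^-1` B))%E.
Proof.
move=> mC mB.
have mXB j (A : set T') : measurable A -> measurable (X j @^-1` A).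
  by move=> mA; rewrite -[X in measurable X]setTI; apply: measurable_funPT.
pose p : {nonneg R} := NngNum (fine_ge0 (measure_ge0 P (X i @^-1` B))).
have pE : P (X i @^-1` B) = p%:num%:E by exact: fine_probability (mXB i B mB).
suff -> : P (C `&` X i @^-1` B) = mscale p P C by rewrite /mscale /= pE muleC.
apply: (@g_sigma_algebra_measure_unique _ R T cylinders cylinders_measurable
  (fun=> setT) _ _ (mrestr P (mXB i B mB)) (mscale p P)) => //.
- move=> _; exists (fun=> setT) => //.
  by apply/seteqP; split=> [t _ j _|].
- by rewrite bigcup_const.
- move=> _ _ [A1 mA1 ->] [A2 mA2 ->]; exists (fun j => A1 j `&` A2 j).
    by move=> j; exact: measurableI.
  by rewrite -bigcapI.
- move=> _ [A mA ->].
  pose A' j := if j == i then B else A j.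
  have mA' j : measurable (A' j) by rewrite /A'; case: ifP.
  have capE : \bigcap_(j in [set j | j \in [set: I]%SET]) X j @^-1` A' j =
     (\bigcap_(j in [set j | j \in [set~ i]%SET]) X j @^-1` A j) `&` X i @^-1` B.
    apply/seteqP; split=> [t h|t [h hi] j _].
      split=> [j /=|]; last by have := h i; rewrite /A' eqxx; apply; rewrite /= inE.
      rewrite !inE => ji; have := h j; rewrite /A' (negbTE ji); apply.
      by rewrite /= inE.
    rewrite /A'; case: eqP => [->//|/eqP ji].
    by apply: h; rewrite /= !inE.
  rewrite -[LHS]/(P (_ `&` _)) -capE indX //.
  rewrite /mscale [X in _ = (_ * X)%E]indX // (bigD1 i) ?inE //= {1}/A' eqxx pE; congr (_ * _)%E.
  apply: eq_big => j; first by rewrite !inE.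
  by rewrite inE /= /A' => /negbTE ->.
- move=> _; apply: le_lt_trans (ltry 1); apply: probability_le1.
  by apply: measurableI => //; exact: mXB.
Qed.

(** By independence the joint law of the other points and of [X i] is a product measure, so a bound
    valid for every section integrates to the same bound. This replaces conditioning on the other
    points. *)
Lemma conditional_bound (S : set (others * T')) (b : R) :
  measurable S -> (forall t : others, (distribution P (X i) (xsection S t) <= b%:E)%E) ->
  measurable [set t : T | S (t, X i t)] /\ (P [set t | S (t, X i t)] <= b%:E)%E.
Proof.
move=> mS Sb.
have mid : measurable_fun setT (id : T -> others).
  by move=> _ C mC; rewrite setTI preimage_id; exact: measurable_others.
have mpair : measurable_fun setT (fun t : T => ((t : others), X i t)).
  by apply/measurable_fun_pairP; split => //; exact: measurable_funPT.
have mSX : measurable [set t : T | S (t, X i t)].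
  by rewrite -[X in measurable X]setTI; exact: (mpair measurableT S mS).
pose Y : {mfun T >-> others} := mfun_Sub (mem_set mid).
pose Z : {mfun T >-> (others * T')%type} := mfun_Sub (mem_set mpair).
split=> //.
have -> : P [set t | S (t, X i t)] = distribution P Z S by [].
rewrite -(@product_measure_unique _ _ _ _ R (distribution P Y) (distribution P (X i))) //.
  rewrite /product_measure1.
  apply: (@le_trans _ _ (\int[distribution P Y]_t (cst b%:E t))%E); last first.
    have Y1 : distribution P Y setT = 1%E by exact: probability_setT.
    by rewrite integral_cst // -[X in (_ * X)%E]/(distribution P Y setT) Y1 mule1.
  apply: ge0_le_integral => //.
  - exact: measurable_fun_xsection.
  - by move=> t _; exact: Sb.
by move=> A B mA mB; exact: independent_others.
Qed.

End Independence.

Section MeasurableEntries.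
Context (d : measure_display) (T : measurableType d) (R : realType).

Definition measurable_entries m n (G : T -> 'M[R]_(m, n)) :=
  forall i j, measurable_fun setT (fun t => G t i j).

Lemma measurable_dot n (u v : T -> 'rV[R]_n) : measurable_entries u ->
  measurable_entries v -> measurable_fun setT (fun t => dot (u t) (v t)).
Proof.
by move=> mu mv; apply: measurable_sum => j; apply: measurable_funM;
  [exact: mu | exact: mv].
Qed.

Lemma measurable_det n (G : T -> 'M[R]_n) : measurable_entries G ->
  measurable_fun setT (fun t => \det (G t)).
Proof.
move=> mG; apply: measurable_sum => s; apply: measurable_funM => //.
by apply: measurable_prod => i _; exact: mG.
Qed.

(** Row [k] is spared because it will hold the tested point, which is left out of the sigma-algebra
    [others]. *)
Lemma measurable_cofactor_row n (G : T -> 'M[R]_n) k :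
  (forall i j, i != k -> measurable_fun setT (fun t => G t i j)) ->
  measurable_entries (fun t => cofactor_row (G t) k).
Proof.
move=> mG i j.
have -> : (fun t => cofactor_row (G t) k i j) = (fun t => cofactor (G t) k j).
  by apply/funext => t; rewrite mxE.
apply: measurable_funM => //; apply: measurable_det => a b.
have -> : (fun t => row' k (col' j (G t)) a b) = (fun t => G t (lift k a) (lift j b)).
  by apply/funext => t; rewrite !mxE.
by apply: mG; rewrite eq_sym neq_lift.
Qed.

Lemma measurable_gap_normal n (G : T -> 'M[R]_n) sg : measurable_entries G ->
  measurable_entries (fun t => gap_normal (G t) sg).
Proof.
move=> mG i j.
have -> : (fun t => gap_normal (G t) sg i j) =
    (fun t => \sum_k (-1) ^+ sg k * cofactor_row (G t) k i j).
  by apply/funext => t; rewrite summxE; apply: eq_bigr => k _; rewrite mxE.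
apply: measurable_sum => k; apply: measurable_funM => //.
by apply: measurable_cofactor_row => a b _; exact: mG.
Qed.

Lemma measurable_near_hyperplane n (delta : R) (w y : T -> 'rV[R]_n) (s : T -> R) :
  measurable_entries w -> measurable_entries y -> measurable_fun setT s ->
  measurable [set t | near_hyperplane delta (w t) (s t) (y t)].
Proof.
move=> mw my ms.
have mww := measurable_dot mw mw.
have -> : [set t | near_hyperplane delta (w t) (s t) (y t)] =
    ~` (setT `&` [set t | dot (w t) (w t) <= 0]) `&`
    (setT `&` [set t | (dot (y t) (w t) - s t) ^+ 2 <= delta ^+ 2 * dot (w t) (w t)]).
  rewrite !setTI; apply/seteqP; split=> [t /= /andP[w0 h]|t /= [w0 h]].
    by split=> //; apply/negP; rewrite -ltNge lt_neqAle eq_sym w0 dot_ge0.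
  by apply/andP; split=> //; apply: contra_notN w0 => /eqP ->.
apply: measurableI; first by apply: measurableC; exact: measurable_fun_le.
apply: measurable_fun_le => //; last exact: measurable_funM.
apply: measurable_funX; apply: measurable_funB => //; exact: measurable_dot.
Qed.

End MeasurableEntries.

Section Borel.
Variables (R : realType) (n : nat).

Lemma measurable_continuous (f : 'rV[R]_n -> R) : continuous f ->
  measurable_fun [set: borel_rV R n] f.
Proof.
move=> /continuousP cf; apply: (measurability _ (RGenOpens.measurableE R)) => //.
move=> _ [_ [a [b ->] <-]]; rewrite setTI.
by apply: sub_sigma_algebra; apply: cf; exact: interval_open.
Qed.

Lemma measurable_coord j : measurable_fun [set: borel_rV R n] (fun y : 'rV[R]_n => y ord0 j).
Proof. by apply: measurable_continuous; exact: coord_continuous. Qed.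

End Borel.

Section RandomPoints.
Context (d : measure_display) (Omega : measurableType d) (R : realType).
Context (P : probability Omega R) (n N : nat).
Variable x : 'I_N -> {RV P >-> borel_rV R n}.
Hypothesis hx : random_points x.
Hypothesis n1 : (1 < n)%N.

Notation others i := (others x i).

Lemma measurable_point i : measurable_entries (fun t : Omega => (x i t : 'rV[R]_n)).
Proof.
move=> a j; rewrite ord1.
apply: (@measurableT_comp _ _ _ _ _ _ (fun y : borel_rV R n => (y : 'rV[R]_n) ord0 j)).
  exact: measurable_coord.
exact: measurable_funPT.
Qed.

Lemma measurable_other_point i j : j != i ->
  measurable_entries (fun t : others i => (x j t : 'rV[R]_n)).
Proof.
move=> ji a l; rewrite ord1 => _ B mB; rewrite setTI.
apply: sub_sigma_algebra; pose C k : set (borel_rV R n) :=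
  if k == j then [set y : 'rV[R]_n | B (y ord0 l)] else setT.
exists C.
  move=> k; rewrite /C; case: ifP => // _.
  by have := measurable_coord l measurableT mB; rewrite setTI.
apply/seteqP; split=> [t Bt k _|t h]; first by rewrite /C /=; case: eqP => // ->.
by have := h j; rewrite /C eqxx; apply; rewrite /= !inE.
Qed.

(** Once the other points are fixed, so are [w] and [s], and dividing by the length of [w] gives a
    slab of half-width [delta] with a unit normal. For [w = 0] the section is empty. *)
Lemma near_hyperplane_bound i (w : others i -> 'rV[R]_n) (s : others i -> R)
    (delta : R) (M : nat) :
  measurable_entries w -> measurable_fun setT s -> (0 < M)%N -> 0 <= delta ->
  64 * n%:R * delta ^+ 2 * M%:R ^+ 4 < 1 ->
  measurable [set t : Omega | near_hyperplane delta (w t) (s t) (x i t)] /\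
  (P [set t | near_hyperplane delta (w t) (s t) (x i t)] <=
    (2 * n%:R / M%:R)%:E)%E.
Proof.
move=> mw ms M0 d0 small.
pose S : set (others i * borel_rV R n) :=
  [set p | near_hyperplane delta (w p.1) (s p.1) p.2].
have mS : measurable S.
  apply: measurable_near_hyperplane.
  - by move=> a j; apply: (measurableT_comp (mw a j)); exact: measurable_fst.
  - move=> a j; rewrite ord1.
    by apply: (measurableT_comp (measurable_coord j)); exact: measurable_snd.
  - by apply: (measurableT_comp ms); exact: measurable_fst.
apply: (conditional_bound hx.1 mS) => t.
have [w0|w0] := eqVneq (w t) 0.
  rewrite (_ : xsection S t = set0) ?measure0 ?lee_fin ?divr_ge0 ?mulr_ge0 //.
  by rewrite -subset0 => y /xsectionP; rewrite /S /near_hyperplane /= w0 dot0l eqxx.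
have ww : 0 < dot (w t) (w t) by rewrite dot_gt0.
pose q := Num.sqrt (dot (w t) (w t)).
have q0 : 0 < q by rewrite sqrtr_gt0.
apply: le_trans (uniform_slab_bound (s t / q) (hx.2 i) n1 (normalize w0) M0 small).
apply: le_measure; rewrite ?inE.
- exact: measurable_xsection.
- by apply: measurable_closed; exact: closed_slab.
move=> y /xsectionP; rewrite /S /= => /andP[_ h].
rewrite dotZr -/q mulrC -mulrBl normrM [X in _ * X]gtr0_norm ?invr_gt0 //.
rewrite ler_pdivrMr // -ler_sqr ?nnegrE ?mulr_ge0 // ?(ltW q0) //.
by rewrite real_normK ?num_real // exprMn sqr_sqrtr // ltW.
Qed.

End RandomPoints.

Lemma spanning_of_unit (R : realType) n N (X : 'M[R]_(N, n)) (i : 'I_n -> 'I_N) :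
  rowsub i X \in unitmx -> spanning_configurations X.
Proof.
move=> uX; exists (invmx (rowsub i X) *m rowsub i 1%:M).
by rewrite -mulmxA mul_rowsub_mx mul1mx mulVmx.
Qed.

(** A feasible functional is at most 1 in absolute value at each point, so at [P x] it is at most
    the l1 norm of the coefficients of [P x]. *)
Lemma not_good_projection (R : realType) n N (X : 'M[R]_(N, n)) (eps : R) :
  (forall f v, dot v f = 1 -> dot f f = 1 ->
    (forall phi, feasible X phi -> forall i,
      `|dot phi (row i X - dot (row i X) f *: v)| <= 1 + eps) -> False) ->
  ~ good_projection (1 + eps) X.
Proof.
move=> hX [P [A [hP AX Ar]]].
have [f [v [vf ff PE]]] := hyperplane_projectionE hP.
apply: (hX f v vf ff) => phi fphi i; rewrite -PE AX dotC dot_mulmx.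
apply: le_trans (ler_norm_sum _ _ _) _; apply: le_trans (ltW (Ar i)).
by apply: ler_sum => k _; rewrite normrM dotC ler_piMr // fphi.
Qed.

(** If [w] and a point share a center, their squared distance is at most
    [2 * (1 / 40 + 1 / 40) = 1 / 10], which means an inner product of at least 19/20. *)
Lemma net_from_centers (R : realType) n N (X : 'M[R]_(N, n)) (I : Type)
    (c : I -> 'rV[R]_n) (s : R) : s <= 1 / 40 ->
  (forall x, dot x x = 1 -> exists q, dot (x - c q) (x - c q) <= s) ->
  (forall i, dot (row i X) (row i X) = 1) ->
  (forall q, exists i, dot (row i X - c q) (row i X - c q) <= s) ->
  forall w, dot w w = 1 -> exists i, 19 / 20 <= `|dot w (row i X)|.
Proof.
move=> s40 cover X1 hit w w1.
have [q wq] := cover w w1; have [i iq] := hit q; exists i.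
apply: le_trans (ler_norm _).
have := triangle_sqr (w - c q) (c q - row i X).
have -> : w - c q + (c q - row i X) = w - row i X by rewrite addrA subrK.
have -> : dot (c q - row i X) (c q - row i X) = dot (row i X - c q) (row i X - c q).
  by rewrite -[c q - row i X]opprB dotNl dotNr opprK.
have -> : dot (w - row i X) (w - row i X) = 2 - 2 * dot w (row i X).
  by rewrite !(dotBl, dotBr) (dotC (row i X) w) w1 X1; ring.
move: wq iq; move: (dot (w - c q) _) (dot (row i X - c q) _) (dot w _) => a b e wq iq h.
lra.
Qed.

Section NetEvents.
Context (d : measure_display) (Omega : measurableType d) (R : realType).
Context (P : probability Omega R).

Lemma exists_bound (J : finType) (A : J -> set Omega) (c : R) :
  (forall j, measurable (A j) /\ (P (A j) <= c%:E)%E) ->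
  measurable [set t | exists j, A j t] /\
  (P [set t | exists j, A j t] <= (#|J|%:R * c)%:E)%E.
Proof.
move=> hA.
have mU : measurable [set t | exists j, A j t].
  have -> : [set t | exists j, A j t] = \bigcup_(j in [set: J]) A j.
    by apply/seteqP; split=> [t [j jt]|t [j _ jt]]; exists j.
  by apply: fin_bigcup_measurable => [|j _]; [exact: finite_finset | exact: (hA j).1].
split=> //; apply: union_bound => [//|j|j|t ht]; last exact: ht.
  exact: (hA j).1.
exact: (hA j).2.
Qed.

(** Lets the union bounds range over all index tuples, with an empty event for those that are not
    admissible. *)
Lemma measurable_if_set (b : bool) (A : set Omega) (c : R) : 0 <= c ->
  (b -> measurable A /\ (P A <= c%:E)%E) ->
  measurable (if b then A else set0) /\ (P (if b then A else set0) <= c%:E)%E.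
Proof. by case: b => [_ /(_ erefl)|c0 _] //; rewrite measure0 lee_fin. Qed.

Variables (n N : nat) (x : 'I_N -> {RV P >-> borel_rV R n}).
Hypothesis n3 : (3 <= n)%N.
Hypothesis hx : random_points x.

Definition configuration (t : Omega) : 'M[R]_(N, n) := \matrix_i (x i t : 'rV[R]_n).

Lemma row_configuration i t : row i (configuration t) = x i t.
Proof. by rewrite rowK. Qed.

Lemma off_sphere_null :
  measurable [set t | exists i, dot (row i (configuration t)) (row i (configuration t)) != 1] /\
  (P [set t | exists i, dot (row i (configuration t)) (row i (configuration t)) != 1%R] <= 0)%E.
Proof.
pose A i := [set t | dot (row i (configuration t)) (row i (configuration t)) != 1].
have [] := @exists_bound _ A 0; last by rewrite mulr0.
move=> i; have AE : A i = x i @^-1` (~` [set y : 'rV[R]_n | dot y y = 1]).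
  apply/seteqP; split=> t; rewrite /A /= row_configuration => h; first by apply/eqP.
  by apply/eqP.
have mS : measurable (~` [set y : 'rV[R]_n | dot y y = 1] : set (borel_rV R n)).
  by apply: measurableC; apply: measurable_closed; exact: closed_sphere.
split; first by rewrite AE -[X in measurable X]setTI; apply: measurable_funPT.
rewrite AE -[P _]/(distribution P (x i) _) probability_setC; last first.
  by apply: measurable_closed; exact: closed_sphere.
by rewrite (uniform_sphere (hx.2 i)) subee.
Qed.

(** By independence a given cap is missed by all [N] points with probability at most
    [(1 - 1 / m^n) ^ N]; there are [m ^ n] caps. *)
Lemma miss_net_bound (m : nat) : (0 < m)%N ->
  exists (c : {ffun 'I_n -> 'I_m} -> 'rV[R]_n),
  let s := 4 * n%:R / m%:R ^+ 2 : R in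
  let B := [set t | exists q, forall i,
    ~ (dot (row i (configuration t) - c q) (row i (configuration t) - c q) <= s)] in
  [/\ forall y, dot y y = 1 -> exists q, dot (y - c q) (y - c q) <= s,
    measurable B &
    (P B <= ((m ^ n)%:R * (1 - (m ^ n)%:R^-1) ^+ N)%:E)%E].
Proof.
move=> m0; have n0 : (0 < n)%N by exact: leq_trans n3.
have [c [c1 cover]] := sphere_net R n0 m0; exists c => s B.
pose cap q := [set y : 'rV[R]_n | dot (y - c q) (y - c q) <= s].
have mcap q : measurable (~` cap q : set (borel_rV R n)).
  by apply: measurableC; apply: measurable_closed; exact: closed_cap.
have capE q : [set t | forall i,
    ~ (dot (row i (configuration t) - c q) (row i (configuration t) - c q) <= s)] =
    \bigcap_(i in [set i | i \in [set: 'I_N]%SET]) x i @^-1` (~` cap q).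
  apply/seteqP; split=> t h i; last by rewrite row_configuration; apply: h; rewrite /= inE.
  by have := h i; rewrite row_configuration.
have mA q : measurable (\bigcap_(i in [set i | i \in [set: 'I_N]%SET]) x i @^-1` (~` cap q)).
  apply: fin_bigcap_measurable => [|i _]; first exact: finite_finset.
  by rewrite -[X in measurable X]setTI; apply: measurable_funPT.
have [|mB PB] := @exists_bound {ffun 'I_n -> 'I_m} (fun q => [set t | forall i,
    ~ (dot (row i (configuration t) - c q) (row i (configuration t) - c q) <= s)])
    ((1 - (m ^ n)%:R^-1) ^+ N).
  move=> q; rewrite capE; split=> //.
  rewrite hx.1 => [|i _]; last exact: mcap.
  have mX i : measurable (x i @^-1` (~` cap q)).
    by rewrite -[X in measurable X]setTI; apply: measurable_funPT.
  rewrite (eq_bigr (fun i => (fine (P (x i @^-1` (~` cap q))))%:E)); last first.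
    by move=> i _; exact: fine_probability.
  rewrite prodEFin lee_fin.
  have -> : (1 - (m ^ n)%:R^-1) ^+ N = \prod_(i in [set: 'I_N]%SET) (1 - (m ^ n)%:R^-1) :> R.
    by rewrite prodr_const cardsT card_ord.
  apply: ler_prod => i _; rewrite fine_ge0 //= -lee_fin -fine_probability //.
  rewrite -[P _]/(distribution P (x i) _) probability_setC; last first.
    by apply: measurable_closed; exact: closed_cap.
  by rewrite EFinB leeB // (uniform_cap_bound (hx.2 i) n0 m0 (c1 q)).
by split=> //; move: PB; rewrite card_ffun !card_ord.
Qed.

End NetEvents.

Section BadEvents.
Context (d : measure_display) (Omega : measurableType d) (R : realType).
Context (P : probability Omega R).
Variables (n N : nat) (x : 'I_N -> {RV P >-> borel_rV R n}).
Hypothesis n3 : (3 <= n)%N.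
Hypothesis hx : random_points x.
Notation X := (configuration x).
Notation tuple_index := {ffun 'I_n -> 'I_N}.

Let n1 : (1 < n)%N := ltnW n3.

Lemma others_rowsub (i : tuple_index) k (a : 'I_n) l : injective i -> a != k ->
  measurable_fun setT (fun t : others x (i k) => rowsub i (X t) a l).
Proof.
move=> iI ak.
have -> : (fun t : others x (i k) => rowsub i (X t) a l) =
    (fun t => (x (i a) t : 'rV[R]_n) ord0 l) by apply/funext => t; rewrite !mxE.
by apply: measurable_other_point; apply: contra_neq ak => /iI.
Qed.

(** The cofactor row at [k] is made of the points other than [i k], which is the one tested against
    it. *)
Lemma basis_failure_bound (delta : R) (M : nat) : (0 < M)%N -> 0 <= delta ->
  64 * n%:R * delta ^+ 2 * M%:R ^+ 4 < 1 ->
  let B := [set t | exists p : tuple_index * 'I_n, injective p.1 /\ near_hyperplane delta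
    (cofactor_row (rowsub p.1 (X t)) p.2) 0 (row (p.1 p.2) (X t))] in
  measurable B /\ (P B <= ((N ^ n * n)%:R * (2 * n%:R / M%:R))%:E)%E.
Proof.
move=> M0 d0 small B.
pose A (p : tuple_index * 'I_n) := if injectiveb p.1 then
  [set t | near_hyperplane delta (cofactor_row (rowsub p.1 (X t)) p.2) 0 (x (p.1 p.2) t)]
  else set0.
have BE : B = [set t | exists p, A p t].
  apply/seteqP; split=> t [p].
    by move=> [/injectiveP pI h]; exists p; rewrite /A pI /= -(row_configuration x).
  by rewrite /A; case: injectiveP => // pI h; exists p; rewrite row_configuration.
have [|] := @exists_bound _ _ _ P _ A (2 * n%:R / M%:R).
  move=> p; apply: measurable_if_set => [|/injectiveP pI]; first by rewrite divr_ge0 ?mulr_ge0.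
  apply: (near_hyperplane_bound hx n1 (s := fun=> 0)) => //.
  by apply: measurable_cofactor_row => a j ak; exact: others_rowsub.
by rewrite -BE card_prod card_ffun !card_ord.
Qed.

(** The tested point is none of those spanning the affine hyperplane, so normal and determinant are
    independent of it. The factor [2 ^ n] counts the sign patterns of the functional. *)
Lemma gap_failure_bound (gamma : R) (M : nat) : (0 < M)%N -> 0 <= gamma ->
  64 * n%:R * gamma ^+ 2 * M%:R ^+ 4 < 1 ->
  let B := [set t | exists p : tuple_index * {ffun 'I_n -> bool} * 'I_N,
    [/\ injective p.1.1, forall k, p.1.1 k != p.2 & near_hyperplane gamma
    (gap_normal (rowsub p.1.1 (X t)) p.1.2) (\det (rowsub p.1.1 (X t))) (row p.2 (X t))]] in
  measurable B /\ (P B <= ((N ^ n * 2 ^ n * N)%:R * (2 * n%:R / M%:R))%:E)%E.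
Proof.
move=> M0 d0 small B.
pose A (p : tuple_index * {ffun 'I_n -> bool} * 'I_N) :=
  if injectiveb p.1.1 && [forall k, p.1.1 k != p.2] then
  [set t | near_hyperplane gamma (gap_normal (rowsub p.1.1 (X t)) p.1.2)
    (\det (rowsub p.1.1 (X t))) (x p.2 t)]
  else set0.
have BE : B = [set t | exists p, A p t].
  apply/seteqP; split=> t [p].
    move=> [/injectiveP pI /forallP pn h]; exists p.
    by rewrite /A pI pn /= -(row_configuration x).
  rewrite /A; case: ifP => // /andP[/injectiveP pI /forallP pn] h.
  by exists p; rewrite row_configuration.
have [|] := @exists_bound _ _ _ P _ A (2 * n%:R / M%:R).
  move=> p; apply: measurable_if_set => [|/andP[/injectiveP pI /forallP pn]].
    by rewrite divr_ge0 ?mulr_ge0.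
  have mA : measurable_entries (fun t : others x p.2 => rowsub p.1.1 (X t)).
    move=> a l; have -> : (fun t : others x p.2 => rowsub p.1.1 (X t) a l) =
        (fun t => (x (p.1.1 a) t : 'rV[R]_n) ord0 l).
      by apply/funext => t; rewrite !mxE.
    exact: measurable_other_point.
  apply: (near_hyperplane_bound hx n1 (s := fun t => \det (rowsub p.1.1 (X t)))) => //.
    exact: measurable_gap_normal.
  exact: measurable_det.
by rewrite -BE !card_prod !card_ffun !card_ord card_bool.
Qed.

(** In each row of the staircase other than the tested one stands a different point or a constant
    vector. With half-width 0 the slab bound [2 n / M] holds for every [M]. *)
Lemma degenerate_null :
  let B := [set t | exists p : tuple_index * 'I_n, injective p.1 /\ near_hyperplane 0
    (cofactor_row (staircase (X t) p.1 p.2) p.2) 0 (row (p.1 p.2) (X t))] in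
  measurable B /\ (P B <= 0)%E.
Proof.
move=> B.
pose A (p : tuple_index * 'I_n) := if injectiveb p.1 then
  [set t | near_hyperplane 0 (cofactor_row (staircase (X t) p.1 p.2) p.2) 0 (x (p.1 p.2) t)]
  else set0.
have BE : B = [set t | exists p, A p t].
  apply/seteqP; split=> t [p].
    by move=> [/injectiveP pI h]; exists p; rewrite /A pI /= -(row_configuration x).
  by rewrite /A; case: injectiveP => // pI h; exists p; rewrite row_configuration.
have [|] := @exists_bound _ _ _ P _ A 0; last by rewrite mulr0 BE.
move=> p; apply: measurable_if_set => // /injectiveP pI.
set C := [set t | _].
have hC M : (0 < M)%N -> measurable C /\ (P C <= (2 * n%:R / M%:R)%:E)%E.
  move=> M0; apply: (near_hyperplane_bound hx n1 (s := fun=> 0)) => //; last first.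
    by rewrite expr0n mulr0 mul0r ltr01.
  apply: measurable_cofactor_row => a j ak.
  have [ap|pa] := ltnP a p.2.
    have -> : (fun t : others x (p.1 p.2) => staircase (X t) p.1 p.2 a j) =
        (fun t => (x (p.1 a) t : 'rV[R]_n) ord0 j).
      by apply/funext => t; rewrite mxE ap row_configuration.
    by apply: measurable_other_point; apply: contra_neq ak => /pI.
  have -> : (fun t : others x (p.1 p.2) => staircase (X t) p.1 p.2 a j) =
      (fun t => (delta_mx ord0 a : 'rV[R]_n) ord0 j).
    by apply/funext => t; rewrite mxE ltnNge pa.
  exact: measurable_cst.
have [mC _] := hC 1%N isT; split=> //.
rewrite (fine_probability P mC) lee_fin leNgt; apply/negP => C0.
pose q : R := fine (P C).
pose M := (Num.truncn (2 * n%:R / q)).+1.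
have [_] := hC M isT; rewrite (fine_probability P mC) lee_fin leNgt => /negP; apply.
have M0 : 0 < M%:R :> R by rewrite ltr0n.
by rewrite ltr_pdivrMr // -ltr_pdivrMl // [ltLHS]mulrC truncnS_gt.
Qed.

End BadEvents.

(** * Choice of the margins and arithmetic of the bounds *)

Section Margins.
Variables (R : realType) (n N : nat).
Hypothesis n3 : (3 <= n)%N.
Hypothesis nN : (n ^ (4 * n) <= N)%N.

(* The margins are what [uniform_slab_bound] allows once the [N ^ n * n] (resp.
   [N ^ n * 2 ^ n * N]) events have to share a total probability of [1 / N]. *)
Definition basis_margin : R := (n%:R ^+ 9 * (N ^ n.+1)%:R ^+ 2)^-1.
Definition gap_margin : R := (n%:R ^+ 3 * (n ^ n.+2)%:R ^+ 2 * (N ^ n.+2)%:R ^+ 2)^-1.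

Lemma n_gt0 : (0 < n)%N. Proof. exact: leq_trans n3. Qed.

Lemma N_gt0 : (0 < N)%N.
Proof. by apply: leq_trans nN; rewrite expn_gt0 n_gt0. Qed.

Lemma n_le_N : (n <= N)%N.
Proof.
apply: leq_trans nN; rewrite -[leqLHS]expn1 leq_pexp2l ?n_gt0 //.
by rewrite muln_gt0 n_gt0.
Qed.

Let u : R := n%:R.

Let u3 : 3 <= u. Proof. by rewrite ler_nat. Qed.

Let u0 : 0 < u. Proof. by apply: lt_le_trans u3. Qed.

(** Both margins are [1 / (n^3 M^2)] for their respective [M], so [64 n delta^2 M^4] reduces to this
    quotient in either case. *)
Let small : 64 * u / u ^+ 6 < 1.
Proof.
rewrite ltr_pdivrMr ?exprn_gt0 // mul1r exprS [64 * u]mulrC ltr_pM2l //.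
apply: (@lt_le_trans _ _ (3 ^+ 5)); first by lra.
by apply: lerXn2r => //; rewrite nnegrE ltW.
Qed.

Let powN_gt0 k : 0 < (N ^ k)%:R :> R.
Proof. by rewrite ltr0n expn_gt0 N_gt0. Qed.

Let pown_gt0 k : 0 < (n ^ k)%:R :> R.
Proof. by rewrite ltr0n expn_gt0 n_gt0. Qed.

Lemma basis_margin_gt0 : 0 < basis_margin.
Proof. by rewrite invr_gt0 mulr_gt0 ?exprn_gt0. Qed.

Lemma gap_margin_gt0 : 0 < gap_margin.
Proof. by rewrite invr_gt0 !mulr_gt0 ?exprn_gt0. Qed.

Lemma basis_margin_le1 : basis_margin <= 1.
Proof.
rewrite invf_le1 ?mulr_gt0 ?exprn_gt0 // -!natrX -natrM ler1n.
by rewrite muln_gt0 !expn_gt0 n_gt0 N_gt0.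
Qed.

Lemma gap_margin_le1 : gap_margin <= 1.
Proof.
rewrite invf_le1 ?mulr_gt0 ?exprn_gt0 // -!natrX -!natrM ler1n.
by rewrite muln_gt0 [X in X && _]muln_gt0 !expn_gt0 n_gt0 N_gt0.
Qed.

Lemma basis_margin_small :
  64 * n%:R * basis_margin ^+ 2 * (n ^ 3 * N ^ n.+1)%:R ^+ 4 < 1.
Proof.
rewrite natrM natrX -/u /basis_margin -/u; move: (powN_gt0 n.+1).
move: (N ^ n.+1)%:R => V V0; move: small; congr (_ < _).
by field; rewrite !gt_eqF.
Qed.

Lemma gap_margin_small :
  64 * n%:R * gap_margin ^+ 2 * (n ^ n.+2 * N ^ n.+2)%:R ^+ 4 < 1.
Proof.
rewrite natrM -/u /gap_margin -/u; move: (powN_gt0 n.+2) (pown_gt0 n.+2).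
move: (N ^ n.+2)%:R (n ^ n.+2)%:R => V z V0 z0; move: small; congr (_ < _).
by field; rewrite !gt_eqF.
Qed.

Lemma basis_failure_le :
  (N ^ n * n)%:R * (2 * n%:R / (n ^ 3 * N ^ n.+1)%:R) <= N%:R^-1 :> R.
Proof.
have NR0 : 0 < N%:R :> R by rewrite ltr0n N_gt0.
have -> : (N ^ n * n)%:R = (N ^ n)%:R * u by rewrite natrM.
have -> : (n ^ 3 * N ^ n.+1)%:R = u ^+ 3 * (N%:R * (N ^ n)%:R).
  by rewrite natrM natrX (expnS N) natrM.
move: (powN_gt0 n); move: (N ^ n)%:R => V V0.
have -> : V * u * (2 * u / (u ^+ 3 * (N%:R * V))) = 2 / u * N%:R^-1.
  by field; rewrite !gt_eqF.
by rewrite ler_piMl ?invr_ge0 // ler_pdivrMr // mul1r (le_trans _ u3) // ler_nat.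
Qed.

Lemma gap_failure_le :
  (N ^ n * 2 ^ n * N)%:R * (2 * n%:R / (n ^ n.+2 * N ^ n.+2)%:R) <= N%:R^-1 :> R.
Proof.
have NR0 : 0 < N%:R :> R by rewrite ltr0n N_gt0.
have -> : (N ^ n * 2 ^ n * N)%:R = (N ^ n)%:R * (2 ^ n)%:R * N%:R :> R.
  by rewrite natrM natrM.
have -> : (n ^ n.+2 * N ^ n.+2)%:R =
    u * (n ^ n.+1)%:R * (N%:R * (N%:R * (N ^ n)%:R)).
  by rewrite natrM (expnS n) natrM (expnS N) natrM (expnS N) natrM.
have h : 2 * (2 ^ n)%:R <= (n ^ n.+1)%:R :> R.
  by rewrite -natrM -expnS ler_nat leq_exp2r // ltnW.
move: h (powN_gt0 n) (pown_gt0 n.+1); move: (N ^ n)%:R (n ^ n.+1)%:R (2 ^ n)%:R.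
move=> V z t h V0 z0.
have -> : V * t * N%:R * (2 * u / (u * z * (N%:R * (N%:R * V)))) = 2 * t / z * N%:R^-1.
  by field; rewrite !gt_eqF.
by rewrite ler_piMl ?invr_ge0 // ler_pdivrMr // mul1r.
Qed.

Lemma c_ge0 : 0 <= c_ R n.
Proof. by rewrite divr_ge0 // exprn_ge0 // expR_ge0. Qed.

(** The denominator of [c_] is at least 1, so [c_] is at most its numerator; the right side is the
    inverse of [4 n^(2n+27) N^(6n+8)], and [exponent_bound] compares the two. *)
Lemma excess_small : c_ R n * N%:R ^- (2 * n ^ 2 + 4 * n + 6) <
  basis_margin ^+ 2 * gap_margin / (4 * n%:R ^+ 2).
Proof.
have cle : c_ R n <= (n ^ (2 * n ^ 2 + 7 * n - 11))%:R.
  rewrite /c_ natrX ler_pdivrMr ?exprn_gt0 ?expR_gt0 // ler_peMr //.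
  by rewrite exprn_ege1 // -expR0 ler_expR.
apply: le_lt_trans (_ : (n ^ (2 * n ^ 2 + 7 * n - 11))%:R *
    N%:R ^- (2 * n ^ 2 + 4 * n + 6) < _).
  by rewrite ler_wpM2r // invr_ge0.
have -> : basis_margin ^+ 2 * gap_margin / (4 * n%:R ^+ 2) =
    (4 * n ^ (2 * n + 27) * N ^ (6 * n + 8))%:R^-1.
  have -> : (4 * n ^ (2 * n + 27) * N ^ (6 * n + 8))%:R =
      4 * u ^+ (2 * n + 27) * N%:R ^+ (6 * n + 8) :> R by rewrite natrM natrM 2!natrX.
  have -> : u ^+ (2 * n + 27) = u ^+ 23 * (n ^ n.+2)%:R ^+ 2.
    by rewrite natrX -exprM -exprD; congr (_ ^+ _); lia.
  have -> : N%:R ^+ (6 * n + 8) = (N ^ n.+1)%:R ^+ 4 * (N ^ n.+2)%:R ^+ 2 :> R.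
    by rewrite !natrX -!exprM -exprD; congr (_ ^+ _); lia.
  rewrite /basis_margin /gap_margin -/u.
  move: (powN_gt0 n.+1) (powN_gt0 n.+2) (pown_gt0 n.+2).
  move: (N ^ n.+1)%:R (N ^ n.+2)%:R (n ^ n.+2)%:R => V W z V0 W0 z0.
  by field; rewrite !gt_eqF.
have C0 : (0 < 4 * n ^ (2 * n + 27) * N ^ (6 * n + 8))%N.
  by rewrite muln_gt0 [X in X && _]muln_gt0 !expn_gt0 n_gt0 N_gt0.
rewrite -natrX ltr_pdivrMr // ltr_pdivlMl ?ltr0n // -natrM ltr_nat mulnC.
exact: exponent_bound.
Qed.

(** For [m = n ^ 3] the squared radius of the caps is [4 / n^5], at most [4 / 243]. *)
Lemma net_scale : 4 * n%:R / (n ^ 3)%:R ^+ 2 <= 1 / 40 :> R.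
Proof.
rewrite natrX -/u.
have -> : 4 * u / (u ^+ 3) ^+ 2 = 4 / u ^+ 5 by field; rewrite gt_eqF.
rewrite ler_pdivrMr ?exprn_gt0 //.
have : 3 ^+ 5 <= u ^+ 5 by apply: lerXn2r => //; rewrite nnegrE ltW.
by lra.
Qed.

(** The number of caps is [a ^ 3] for [a = n ^ n >= 27], and the assumption on [N] reads
    [a ^ 4 <= N]. *)
Lemma net_failure_le :
  ((n ^ 3) ^ n)%:R * (1 - ((n ^ 3) ^ n)%:R^-1) ^+ N <= N%:R^-1 :> R.
Proof.
apply: (@net_failure_bound _ _ _ (n ^ n)).
- apply: leq_trans (_ : 3 ^ n <= _)%N; last by rewrite leq_exp2r // n_gt0.
  by apply: leq_trans (_ : 3 ^ 3 <= _)%N; rewrite ?leq_exp2l.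
- by rewrite -!expnM mulnC.
- by rewrite -expnM mulnC.
Qed.

End Margins.

(** * The probability estimate *)

Theorem theorem1p2 (R : realType) (n N : nat) (hn : (3 <= n)%N)
    (hN : (n ^ (4 * n) <= N)%N)
    (d : measure_display) (Omega : measurableType d) (P : probability Omega R)
    (x : 'I_N -> {RV P >-> borel_rV R n}) (hx : random_points x) :
  let E := [set w : Omega |
    hyperplane_projections_ge (symmetric_hull (fun i => x i w))
      (1 + c_ R n * N%:R ^- (2 * n ^ 2 + 4 * n + 6))] in
  measurable E /\ ((1 - 3 / N%:R)%:E <= P E)%E.
Proof.
move=> E; pose eps : R := c_ R n * N%:R ^- (2 * n ^ 2 + 4 * n + 6).
pose X := configuration x.
have N0 := N_gt0 hn hN; have n0 := n_gt0 hn.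
(* A difference of preimages of two open sets of configurations, hence measurable. *)
have EE : E = X @^-1` @spanning_configurations R n N `\`
    X @^-1` (@spanning_configurations R n N `&` good_projection (1 + eps)).
  have hullE t : (fun i => x i t) = (fun i => row i (X t)) :> ('I_N -> 'rV[R]_n).
    by apply/funext => i; rewrite row_configuration.
  apply/seteqP; split=> t; rewrite /E /= hullE => /=.
    by move/(hyperplane_projections_geE _ N0) => [sp ng]; split=> // -[].
  by move=> [sp ng]; apply/(hyperplane_projections_geE _ N0); split=> // g; apply: ng.
have mX i j : measurable_fun setT (fun t => X t i j).
  have -> : (fun t => X t i j) = (fun t => (x i t : 'rV[R]_n) ord0 j).
    by apply/funext => t; rewrite mxE.
  exact: measurable_point.
have mE : measurable E.
  rewrite EE; apply: measurableD; apply: measurable_preimage_open => //.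
    exact: open_spanning.
  exact: open_good_projection.
split=> //.
have M2 : (0 < n ^ 3 * N ^ n.+1)%N by rewrite muln_gt0 !expn_gt0 n0 N0.
have M3 : (0 < n ^ n.+2 * N ^ n.+2)%N by rewrite muln_gt0 !expn_gt0 n0 N0.
have m0 : (0 < n ^ 3)%N by rewrite expn_gt0 n0.
have [mB0 PB0] := off_sphere_null hx; set B0 := [set t | _] in mB0 PB0.
have [mB4 PB4] := degenerate_null hn hx; set B4 := [set t | _] in mB4 PB4.
have [c [cover mB1 PB1]] := miss_net_bound hn hx m0.
set B1 := [set t | _] in mB1 PB1.
have [mB2 PB2] := basis_failure_bound hn hx M2 (ltW (basis_margin_gt0 R hn hN))
  (basis_margin_small R hn hN).
set B2 := [set t | _] in mB2 PB2.
have [mB3 PB3] := gap_failure_bound hn hx M3 (ltW (gap_margin_gt0 R hn hN))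
  (gap_margin_small R hn hN).
set B3 := [set t | _] in mB3 PB3.
have bad : ~` E `<=` B0 `|` B4 `|` B1 `|` B2 `|` B3.
  move=> t nE; apply: contrapT => /not_orP[/not_orP[/not_orP[/not_orP[n_0 n_4] n_1] n_2] n_3].
  apply: nE; rewrite EE.
  have X1 i : dot (row i (X t)) (row i (X t)) = 1.
    by apply/eqP; apply: contrapT => /negP h; apply: n_0; exists i.
  (* The bad events are indexed by finite functions and the deterministic statements by arbitrary
     ones, which accounts for the passage through [[ffun k => i k]]. *)
  have unitX (i : 'I_n -> 'I_N) : injective i -> rowsub i (X t) \in unitmx.
    move=> iI; have fE : rowsub i (X t) = rowsub [ffun k => i k] (X t).
      by apply/matrixP => a b; rewrite !mxE ffunE.
    rewrite fE; apply: staircase_unit => k; apply/negP => h; apply: n_4.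
    exists ([ffun k => i k], k); split=> // a b; rewrite /= !ffunE; exact: iI.
  have widenI : injective (widen_ord (n_le_N hn hN)).
    by move=> a b /(congr1 val) /= /val_inj.
  split; first exact: spanning_of_unit (unitX _ widenI).
  move=> [_]; apply: not_good_projection => f v vf ff proj.
  apply: (@no_good_projection R n N (X t) (basis_margin R n N) (gap_margin R n N)
    hn (n_le_N hn hN) X1 _ unitX _ _ _ _ f v eps vf ff _ _ proj).
  - apply: (net_from_centers (net_scale R hn) cover X1) => q.
    by apply: contrapT => h; apply: n_1; exists q => i hi; apply: h; exists i.
  - move=> i k y iI y1.
    have fE : rowsub i (X t) = rowsub [ffun k => i k] (X t).
      by apply/matrixP => a b; rewrite !mxE ffunE.
    rewrite fE; apply: coord_bound => //; first exact: ltW (basis_margin_gt0 R hn hN).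
      by rewrite -fE unitX.
    apply/negP => h; apply: n_2; exists ([ffun k => i k], k); split=> //.
    by move=> a b; rewrite /= !ffunE; exact: iI.
  - move=> i phi j iI phi1 ij.
    apply: (@gap_bound _ _ _ (X t) i) => //; first exact: ltW (gap_margin_gt0 R hn hN).
      exact: unitX.
    have fE : rowsub i (X t) = rowsub [ffun k => i k] (X t).
      by apply/matrixP => a b; rewrite !mxE ffunE.
    move=> sg; apply/negP => h; apply: n_3; exists ([ffun k => i k], sg, j).
    rewrite /= -fE; split=> // [a b|k]; rewrite ?ffunE //; exact: iI.
  - by rewrite basis_margin_gt0 // basis_margin_le1.
  - by rewrite gap_margin_gt0 // gap_margin_le1.
  - by rewrite mulr_ge0 ?c_ge0 // invr_ge0.
  - exact: excess_small.
(* Two of the five events are null: points off the sphere and degenerate staircases. Each of the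
   other three costs [1 / N]. *)
have PnE : (P (~` E) <= (3 / N%:R)%:E)%E.
  have NR : 3 / N%:R = 0 + 0 + N%:R^-1 + N%:R^-1 + N%:R^-1 :> R by ring.
  have mU4 : measurable (B0 `|` B4) by exact: measurableU.
  have mU1 : measurable (B0 `|` B4 `|` B1) by exact: measurableU.
  have mU2 : measurable (B0 `|` B4 `|` B1 `|` B2) by exact: measurableU.
  rewrite NR; apply: le_trans (le_measure P _ _ bad) _; rewrite ?inE.
  - exact: measurableC.
  - exact: measurableU.
  rewrite !EFinD; apply: le_trans (measureU2 _ mU2 mB3) _; apply: leeD; last first.
    by apply: le_trans PB3 _; rewrite lee_fin gap_failure_le.
  apply: le_trans (measureU2 _ mU1 mB2) _; apply: leeD; last first.
    by apply: le_trans PB2 _; rewrite lee_fin basis_failure_le.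
  apply: le_trans (measureU2 _ mU4 mB1) _; apply: leeD; last first.
    by apply: le_trans PB1 _; rewrite lee_fin net_failure_le.
  by apply: le_trans (measureU2 _ mB0 mB4) _; exact: leeD.
have := probability_setC P (measurableC mE); rewrite setCK => ->.
by rewrite EFinB leeB.
Qed.
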